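(* The only quaternionic tori $T$ with a non-trivial group of biregular automorphisms, $Aut(T)\neq\{\pm 1\}$, are those corresponding to the elements of $\mathcal M$ of the following two types. That is, for a quaternionic torus $T$ one has $Aut(T)\neq\{\pm1\}$ if and only if at least one of the following holds: (i) there exist $I\in\mathbb H$ with $I^2=-1$ and $\alpha_3\in\mathbb H$ with $|\alpha_3|\ge 1$ such that $(I,\alpha_3,\alpha_3 I)\in\mathcal M$ and $T$ corresponds to $(I,\alpha_3,\alpha_3 I)$; (ii) there exist $I\in\mathbb H$ with $I^2=-1$ and $\alpha_3\in\mathbb H$ with $|\alpha_3|\ge 1$ such that $(e^{\frac{\pi I}{3}},\alpha_3,\alpha_3 e^{\frac{\pi I}{3}})\in\mathcal M$ and $T$ corresponds to $(e^{\frac{\pi I}{3}},\alpha_3,\alpha_3 e^{\frac{\pi I}{3}})$. Moreover, in case (i) $Aut(T)$ contains a subgroup isomorphic to $2C_2$, and in case (ii) $Aut(T)$ contains a subgroup isomorphic to $2C_3$.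
   Context: $\mathbb H\cong\mathbb R^4$ is the skew field of quaternions with its Euclidean scalar product $\langle\cdot,\cdot\rangle$ and norm $|\cdot|$; $\mathbb S=\{q\in\mathbb H: q^2=-1\}$, $\mathbb S^3=\{q\in\mathbb H:|q|=1\}$, and $e^{\alpha I}=\cos\alpha+I\sin\alpha$ for $I\in\mathbb S$, $\alpha\in\mathbb R$. A function $f:\Omega\to\mathbb H$ on a domain $\Omega\subseteq\mathbb H$ is (slice) regular if for every $I\in\mathbb S$ its restriction $f_I$ to $\Omega\cap(\mathbb R+I\mathbb R)$ has continuous derivatives and $\frac12\left(\frac{\partial}{\partial x}+I\frac{\partial}{\partial y}\right)f_I(x+Iy)=0$. A rank-4 lattice $L\subset\mathbb H$ is the additive subgroup generated by four $\mathbb R$-linearly independent elements. A quaternionic torus is a quotient $T=\mathbb H/L$, $L$ a rank-4 lattice, with the atlas of local inverses of the projection $\pi:\mathbb H\to\mathbb H/L$ on small connected open sets. A map between two quaternionic tori is regular if its expressions in these charts are slice regular; a biregular diffeomorphism is a bijective regular map with regular inverse. Two tori are equivalent if there is a biregular diffeomorphism of one onto the other. For $T=\mathbb H/L$, $Aut(T)$ is the group (under composition) of maps $F:\mathbb H\to\mathbb H$, $F(q)=qa$, with $a\in\mathbb S^3$ and $F(L)=L$; $\{\pm1\}$ denotes the subgroup $\{q\mapsto q,\ q\mapsto -q\}$. The Gram matrix of an (ordered) basis $\{v_1,v_2,v_3,v_4\}$ of a rank-4 lattice is $(\langle v_i,v_j\rangle)_{i,j}$. A Gram matrix $R=(r_{i,j})$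 is reduced (in the sense of Minkowski–Siegel) if and only if: B1) $r_{k,k+1}\ge 0$ for $k=1,2,3$; B2) for each $k=1,2,3,4$, $n R\,{}^tn\ge r_{k,k}$ for every $n=(n_1,n_2,n_3,n_4)\in\mathbb Z^4$ such that $\gcd(n_k,\dots,n_4)=1$. A basis of a lattice is reduced if its Gram matrix is reduced, and a special basis is a reduced basis whose first element is $1$. Set $\mathcal M=\{(v_2,v_3,v_4)\in\mathbb H^3:\{1,v_2,v_3,v_4\}\text{ is a special basis}\}$ (the special basis of the lattice it generates). A torus $T$ corresponds to $(v_2,v_3,v_4)\in\mathcal M$ if $T$ is equivalent to $\mathbb H/(\mathbb Z+\mathbb Zv_2+\mathbb Zv_3+\mathbb Zv_4)$. $2C_n$ denotes the cyclic group of order $2n$ generated in $\mathbb S^3$ by $e^{\pi I/n}$ ($I\in\mathbb S$). *)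

(* Defs.v *)
From HB Require Import structures.
From mathcomp Require Import all_boot all_order all_algebra ring.
From mathcomp Require Import all_classical all_reals all_analysis.

Set Implicit Arguments.
Unset Strict Implicit.
Unset Printing Implicit Defensive.

Import Order.TTheory GRing.Theory Num.Theory.
Import numFieldNormedType.Exports.

Local Open Scope classical_set_scope.
Local Open Scope ring_scope.

(* Pitfall: the norm `|q| inherited from row vectors is the sup norm. It is used
   only for the topology (the Euclidean one); the Euclidean norm |q| of the
   quaternions is [qnorm] below. *)
Definition quat (R : realType) : Type := 'rV[R]_4.

Section QuatRing.
Variable R : realType.

HB.instance Definition _ := NormedModule.copy (quat R) 'rV[R]_4.
HB.instance Definition _ := Complete.copy (quat R) 'rV[R]_4.
HB.instance Definition _ := Vector.copy (quat R) 'rV[R]_4.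

Implicit Types p q r : quat R.

Definition mkquat (a b c d : R) : quat R :=
  \row_(i < 4) nth 0 [:: a; b; c; d] i.

Definition qre q : R := q 0 (inord 0).
Definition qi q : R := q 0 (inord 1).
Definition qj q : R := q 0 (inord 2).
Definition qk q : R := q 0 (inord 3).

Definition qone : quat R := mkquat 1 0 0 0.

(* Hamilton's rules i^2 = j^2 = k^2 = ijk = -1. *)
Definition qmul p q : quat R :=
  mkquat
    (qre p * qre q - qi p * qi q - qj p * qj q - qk p * qk q)
    (qre p * qi q + qi p * qre q + qj p * qk q - qk p * qj q)
    (qre p * qj q - qi p * qk q + qj p * qre q + qk p * qi q)
    (qre p * qk q + qi p * qj q - qj p * qi q + qk p * qre q).

Lemma quatP p q :
  qre p = qre q -> qi p = qi q -> qj p = qj q -> qk p = qk q -> p = q.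
Proof.
move=> h0 h1 h2 h3; apply/rowP => i.
by case: i => [[|[|[|[|//]]]] lti]; rewrite -[Ordinal lti]inord_val.
Qed.

Lemma qre_mk a b c d : qre (mkquat a b c d) = a.
Proof. by rewrite /qre mxE inordK. Qed.
Lemma qi_mk a b c d : qi (mkquat a b c d) = b.
Proof. by rewrite /qi mxE inordK. Qed.
Lemma qj_mk a b c d : qj (mkquat a b c d) = c.
Proof. by rewrite /qj mxE inordK. Qed.
Lemma qk_mk a b c d : qk (mkquat a b c d) = d.
Proof. by rewrite /qk mxE inordK. Qed.

Definition quat_mkE := (qre_mk, qi_mk, qj_mk, qk_mk).

Lemma qreD p q : qre (p + q) = qre p + qre q. Proof. by rewrite /qre mxE. Qed.
Lemma qiD p q : qi (p + q) = qi p + qi q. Proof. by rewrite /qi mxE. Qed.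
Lemma qjD p q : qj (p + q) = qj p + qj q. Proof. by rewrite /qj mxE. Qed.
Lemma qkD p q : qk (p + q) = qk p + qk q. Proof. by rewrite /qk mxE. Qed.

Definition quatDE := (qreD, qiD, qjD, qkD).

Lemma qreZ a q : qre (a *: q) = a * qre q. Proof. by rewrite /qre mxE. Qed.
Lemma qiZ a q : qi (a *: q) = a * qi q. Proof. by rewrite /qi mxE. Qed.
Lemma qjZ a q : qj (a *: q) = a * qj q. Proof. by rewrite /qj mxE. Qed.
Lemma qkZ a q : qk (a *: q) = a * qk q. Proof. by rewrite /qk mxE. Qed.

Definition quatZE := (qreZ, qiZ, qjZ, qkZ).

Fact qmulA : associative qmul.
Proof. by move=> p q r; apply: quatP; rewrite !quat_mkE; ring. Qed.
Fact qmul1q : left_id qone qmul.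
Proof. by move=> q; apply: quatP; rewrite !quat_mkE; ring. Qed.
Fact qmulq1 : right_id qone qmul.
Proof. by move=> q; apply: quatP; rewrite !quat_mkE; ring. Qed.
Fact qmulDl : left_distributive qmul +%R.
Proof.
by move=> p q r; apply: quatP; rewrite !(quat_mkE, quatDE); ring.
Qed.
Fact qmulDr : right_distributive qmul +%R.
Proof.
by move=> p q r; apply: quatP; rewrite !(quat_mkE, quatDE); ring.
Qed.
Fact qone_neq0 : qone != 0.
Proof.
apply/eqP => /(congr1 qre); rewrite qre_mk /qre mxE => /eqP.
by rewrite oner_eq0.
Qed.

HB.instance Definition _ := GRing.Zmodule_isNzRing.Build (quat R)
  qmulA qmul1q qmulq1 qmulDl qmulDr qone_neq0.

Fact qscalerAl (a : R) p q : a *: (p * q) = (a *: p) * q.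
Proof. by apply: quatP; rewrite !(quatZE, quat_mkE); ring. Qed.
Fact qscalerAr (a : R) p q : a *: (p * q) = p * (a *: q).
Proof. by apply: quatP; rewrite !(quatZE, quat_mkE); ring. Qed.

HB.instance Definition _ :=
  GRing.Lmodule_isLalgebra.Build R (quat R) qscalerAl.
HB.instance Definition _ :=
  GRing.Lalgebra_isAlgebra.Build R (quat R) qscalerAr.

End QuatRing.

Section Quaternions.
Variable R : realType.
Implicit Types p q I : quat R.

Definition qdot p q : R := \sum_(i < 4) p 0 i * q 0 i.

Definition qnorm q : R := Num.sqrt (qdot q q).

Definition imag_units : set (quat R) := [set q | q ^+ 2 = -1].

Definition unit_sphere : set (quat R) := [set q | qnorm q = 1].

(* e^{alpha I} *)
Definition qexp (alpha : R) I : quat R := (cos alpha)%:A + sin alpha *: I.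

(* (x, y) |-> f (x + I y) *)
Definition slice (f : quat R -> quat R) I (z : R * R) : quat R :=
  f (z.1%:A + z.2 *: I).

(* [f] is total; only its values on the set [U], open in all uses, matter. *)
Definition slice_regular (U : set (quat R)) (f : quat R -> quat R) : Prop :=
  forall I, imag_units I ->
  forall z : R * R, U (z.1%:A + z.2 *: I) ->
  let dx := 'D_(1, 0) (slice f I) in
  let dy := 'D_(0, 1) (slice f I) in
  [/\ derivable (slice f I) z (1, 0) /\ derivable (slice f I) z (0, 1),
      {for z, continuous dx} /\ {for z, continuous dy} &
      2^-1 *: (dx z + I * dy z) = 0].

Definition zspan (v : 4.-tuple (quat R)) : set (quat R) :=
  [set q | exists n : 'I_4 -> int, q = \sum_(i < 4) tnth v i *~ n i].

Record lattice := Lattice {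
  lat_set :> set (quat R);
  lat_basis : exists v : 4.-tuple (quat R), free v /\ lat_set = zspan v }.

Definition lat_pred (L : lattice) : {pred quat R} := fun q => `[< lat_set L q >].

Fact lat_zmod_closed (L : lattice) : zmod_closed (lat_pred L).
Proof.
have [v [_ Lv]] := lat_basis L.
split=> [|p q /asboolP]; first apply/asboolP; rewrite Lv.
  by exists (fun=> 0); rewrite big1.
move=> [m ->] /asboolP; rewrite Lv => -[n ->]; apply/asboolP; rewrite Lv.
exists (fun i => m i - n i); rewrite -sumrB.
by apply: eq_bigr => i _; rewrite mulrzBr.
Qed.

HB.instance Definition _ (L : lattice) :=
  GRing.isZmodClosed.Build (quat R) (lat_pred L) (lat_zmod_closed L).

Definition torus (L : lattice) := quotient_topology (Quotient.quot (lat_pred L)).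

Definition torus_proj (L : lattice) : quat R -> torus L := \pi_(torus L)%qT.

(* The sets V such that the inverse of the projection restricted to V is a
   chart of the torus, and this chart (extended by 0 off the image of V). *)
Definition chart_domain (L : lattice) (V : set (quat R)) : Prop :=
  [/\ open V, connected V & {in V &, injective (torus_proj L)}].

Definition chart (L : lattice) (V : set (quat R)) : torus L -> quat R :=
  'pinv_(fun=> 0) V (torus_proj L).

Definition regular_map (L L' : lattice) (f : torus L -> torus L') : Prop :=
  continuous f /\
  forall V V' : set (quat R), chart_domain L V -> chart_domain L' V' ->
    slice_regular
      (V `&` (f \o torus_proj L) @^-1` (torus_proj L' @` V'))
      (chart V' \o f \o torus_proj L).

Definition equivalent_tori (L L' : lattice) : Prop :=
  exists (f : torus L -> torus L') (g : torus L' -> torus L),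
    [/\ cancel f g, cancel g f, regular_map f & regular_map g].

Definition Aut (L : lattice) : set (quat R -> quat R) :=
  [set F | exists2 a, unit_sphere a &
     F = (fun q => q * a) /\ F @` L = L :> set (quat R)].

Definition pm1 : set (quat R -> quat R) := [set (fun q => q); (fun q => - q)].

Definition gram (v : 4.-tuple (quat R)) : 'M[R]_4 :=
  \matrix_(i, j) qdot (tnth v i) (tnth v j).

(* Indices run over 0, ..., 3 instead of 1, ..., 4. *)
Definition reduced_gram (A : 'M[R]_4) : Prop :=
  (forall i j : 'I_4, j = i.+1 :> nat -> 0 <= A i j) /\
  (forall (k : 'I_4) (n : 'rV[int]_4),
     \big[gcdn/0%N]_(i < 4 | (k <= i)%N) `|n ord0 i|%N = 1%N ->
     let m := map_mx intr n : 'rV[R]_4 in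
     A k k <= (m *m A *m m^T) 0 0).

Definition special_basis (v : 4.-tuple (quat R)) : Prop :=
  [/\ free v, reduced_gram (gram v) & tnth v 0 = 1].

Definition moduli : set (quat R * quat R * quat R) :=
  [set t | special_basis [tuple 1; t.1.1; t.1.2; t.2]].

Definition corresponds (L : lattice) (t : quat R * quat R * quat R) : Prop :=
  exists2 L' : lattice,
    L' = zspan [tuple 1; t.1.1; t.1.2; t.2] :> set (quat R) &
    equivalent_tori L L'.

Definition type1 (L : lattice) : Prop :=
  exists I alpha3 : quat R,
    [/\ I ^+ 2 = -1, 1 <= qnorm alpha3,
        moduli (I, alpha3, alpha3 * I) &
        corresponds L (I, alpha3, alpha3 * I)].

Definition type2 (L : lattice) : Prop :=
  exists I alpha3 : quat R,
    let e := qexp (pi / 3) I in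
    [/\ I ^+ 2 = -1, 1 <= qnorm alpha3,
        moduli (e, alpha3, alpha3 * e) &
        corresponds L (e, alpha3, alpha3 * e)].

(* The group 2C_n generated by e^{pi I / n}; as this element has finite order,
   its natural powers suffice. *)
Definition cyclic2 (n : nat) I : set (quat R) :=
  [set q | exists k : nat, q = qexp (pi / n%:R) I ^+ k].

(* Subgroups of the group of bijections of the quaternions. *)
Definition comp_group (B : set (quat R -> quat R)) : Prop :=
  [/\ B (fun q => q),
      forall F G, B F -> B G -> B (F \o G) &
      forall F, B F -> exists G, [/\ B G, cancel F G & cancel G F]].

Definition has_subgroup_isom (A : set (quat R -> quat R)) (G : set (quat R)) :
    Prop :=
  exists B : set (quat R -> quat R),
    [/\ B `<=` A, comp_group B &
        exists phi : quat R -> (quat R -> quat R),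
          set_bij G B phi /\
          forall p q, G p -> G q -> phi (p * q) = phi p \o phi q].

End Quaternions.

Arguments pm1 : clear implicits.

(* Main.v *)
From HB Require Import structures.
Require Import Defs.
From mathcomp Require Import all_boot all_order all_algebra.
From mathcomp Require Import all_classical all_reals all_analysis.
From mathcomp Require Import ring lra zify.

Set Implicit Arguments.
Unset Strict Implicit.
Unset Printing Implicit Defensive.

Import Order.TTheory GRing.Theory Num.Theory.
Import numFieldNormedType.Exports.

Local Open Scope classical_set_scope.
Local Open Scope ring_scope.

(** Why the theorem is true.

    An automorphism of [H / L] is a right multiplication by a unit quaternion
    [a] with [L a = L]. Suppose that [a] is not a sign. Multiplying [L] on the
    right by the inverse of a shortest vector, which conjugates [a], makes [1]
    a shortest vector. Then [a = 1 a] lies in [L], and so does the real number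
    [a + a^-1 = 2 Re a]. No nonzero vector of [L] is shorter than [1], hence
    this number is an integer, and its absolute value is less than [2]. Up to
    sign, [a] is thus an imaginary unit [I] or [exp (pi I / 3)], and [L] is a
    right module over the Gaussian or Eisenstein integers [O = Z + Z a]. Both
    rings are Euclidean, and division with remainder, applied to the component
    of a vector orthogonal to the slice of [I] and then to its component in
    the slice, gives [L = O + al O] for a shortest vector [al] outside the
    slice ([reduced_basis_ex]). The basis [1, a, al, al a] is special: the
    inequalities B2 hold because [1] is shortest in [L] and [al] is shortest
    outside the slice, and B1 only asks for the right choice between [al] and
    [- al]. This is [nontrivial_type].

    For the converse an equivalence of tori must be known to come from a
    similarity of lattices ([equivalent_tori_similar]). Let [f] be a regular
    map between tori. For a small real [h], the increment [F (q + h) - F q] of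
    a local lift [F] of [f] does not depend on the lift, and it is a continuous
    periodic function of [q] that is slice regular on the whole space. Such a
    function is constant ([torus_liouville]): its inner product with a fixed
    vector attains its maximum by compactness, at a point of some slice. In
    that slice this real function is harmonic, so it is constant there by the
    mean value property ([harmonic_max]). All slices contain [0], so the
    maximum is the value at [0], for every choice of the vector; this is only
    possible for a constant. Hence all lifts have the same constant derivative
    and [f] is induced by an affine map [q |-> q a + b] ([regular_map_affine]).
    When [f] is invertible this gives [L a = L'].

    If [H / L] is of type 1 or 2, then [L] is similar to a lattice
    [O + al O], and multiplication by the generator [I] or [exp (pi I / 3)]
    of the units of [O] is carried by the similarity to an automorphism of
    [H / L] of order [4] or [6], whose powers form the required subgroup
    ([preserves_subgroup]). *)

(** * Differentiable functions of the plane *)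

Lemma is_diff_eps (K : numFieldType) (V W : normedModType K) (f : V -> W)
    (df : {linear V -> W}) (x : V) : continuous df ->
  (forall e, 0 < e ->
    \forall h \near 0, `|f (h + x) - (f x + df h)| <= e * `|h|) ->
  is_diff x f df.
Proof.
move=> dfc small.
have E : f \o shift x = cst (f x) + df +o_ 0 id.
  by apply/eqaddoP => e e0; exact: small.
by have dE := diff_unique dfc E; constructor=> //; apply/diff_locallyP; rewrite dE.
Qed.

Section PlaneCalculus.
Variable R : realType.
Implicit Types (p px py : R * R -> R) (z : R * R).

Lemma is_derive_hline (W : normedModType R) (p : R * R -> W) (x y : R) (dp : W) :
  is_derive (x, y) (1, 0) p dp <-> is_derive x 1 (fun t => p (t, y)) dp.
Proof.
have E : (fun h : R => h^-1 *: ((p \o shift (x, y)) (h *: (1, 0)) - p (x, y))) =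
    (fun h : R => h^-1 *: (((fun t => p (t, y)) \o shift x) (h *: 1) - p (x, y))).
  apply/funext => h /=; congr (_ *: (p _ - _)).
  by congr pair => /=; rewrite ?scaler0 ?add0r.
by split=> -[d v]; constructor; move: d v; rewrite /derivable /derive E.
Qed.

Lemma is_derive_vline (W : normedModType R) (p : R * R -> W) (x y : R) (dp : W) :
  is_derive (x, y) (0, 1) p dp <-> is_derive y 1 (fun t => p (x, t)) dp.
Proof.
have E : (fun h : R => h^-1 *: ((p \o shift (x, y)) (h *: (0, 1)) - p (x, y))) =
    (fun h : R => h^-1 *: (((fun t => p (x, t)) \o shift y) (h *: 1) - p (x, y))).
  apply/funext => h /=; congr (_ *: (p _ - _)).
  by congr pair => /=; rewrite ?scaler0 ?add0r.
by split=> -[d v]; constructor; move: d v; rewrite /derivable /derive E.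
Qed.

Lemma MVT_unordered (f df : R -> R) (a b : R) :
  (forall t : R, `|t - a| <= `|b - a| -> is_derive t 1 f (df t)) ->
  exists2 c, `|c - a| <= `|b - a| & f b - f a = df c * (b - a).
Proof.
move=> dfE.
have [ab|/ltW ba] := leP a b.
  have H t : t \in `[a, b] -> `|t - a| <= `|b - a|.
    rewrite in_itv/= => /andP[aT tb].
    by rewrite !ger0_norm ?subr_ge0// lerD2r.
  have cf : {within `[a, b], continuous f}.
    by apply: derivable_within_continuous => t /H/dfE[].
  have [c /H cI ->] := @MVT_segment _ f df a b ab
    (fun t tI => dfE t (H t (subset_itv_oo_cc tI))) cf.
  by exists c.
have H t : t \in `[b, a] -> `|t - a| <= `|b - a|.
  rewrite in_itv/= => /andP[bt ta].
  by rewrite !ler0_norm ?subr_le0// lerN2 lerD2r.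
have cf : {within `[b, a], continuous f}.
  by apply: derivable_within_continuous => t /H/dfE[].
have [c /H cI E] := @MVT_segment _ f df b a ba
  (fun t tI => dfE t (H t (subset_itv_oo_cc tI))) cf.
by exists c => //; rewrite -opprB E -mulrN opprB.
Qed.

(** Moving first vertically and then horizontally, the mean value theorem
    turns the increment of [p] into partial derivatives at nearby points. *)
Lemma C1_is_diff p px py :
  (forall z, is_derive z (1, 0) p (px z)) ->
  (forall z, is_derive z (0, 1) p (py z)) ->
  continuous px -> continuous py ->
  forall z, is_diff z p (fun h => px z * h.1 + py z * h.2).
Proof.
move=> dx dy cx cy [x y]; pose z := (x, y).
pose L (h : R * R) := px z * h.1 + py z * h.2.
have Llin : linear L.
  move=> a u v; rewrite /L /= -[a *: u.1]/(a * u.1) -[a *: u.2]/(a * u.2).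
  by rewrite -[a *: _]/(a * _); ring.
pose LL : {linear _ -> _} := HB.pack L (GRing.isLinear.Build _ _ _ _ _ Llin).
have Lc : continuous LL.
  move=> u; rewrite /LL /= /L.
  apply: cvgD; apply: cvgM; first exact: cvg_cst.
  - exact: cvg_fst.
  - exact: cvg_cst.
  - exact: cvg_snd.
have LE : (fun h : R * R => px z * h.1 + py z * h.2) = LL by [].
rewrite LE; apply: is_diff_eps => // _ /posnumP[e].
  have e2 : 0 < e%:num / 2 by [].
  have /cvgrPdist_lt/(_ _ e2)/nbhs_ballP[d1 /= d1p B1] := cx z.
  have /cvgrPdist_lt/(_ _ e2)/nbhs_ballP[d2 /= d2p B2] := cy z.
  suff H (h : R * R) : `|h| < d1 -> `|h| < d2 ->
      `|p (h + z) - (p z + L h)| <= e%:num * `|h|.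
    near=> h; apply: H; near: h; exact: (@nbhs0_lt _ (R * R)%type).
  case: h => h k.
  rewrite !prod_normE/= !gt_max => /andP[h1 k1] /andP[h2 k2].
  have [c1 c1P E1] := @MVT_unordered (fun t => p (t, k + y)) (fun t => px (t, k + y))
     x (h + x) (fun t _ => iffLR (is_derive_hline _ _ _ _) (dx (t, k + y))).
  have [c2 c2P E2] := @MVT_unordered (fun t => p (x, t)) (fun t => py (x, t))
     y (k + y) (fun t _ => iffLR (is_derive_vline _ _ _ _) (dy (x, t))).
  have -> : p ((h, k) + (x, y)) - (p (x, y) + L (h, k)) =
     - (px (x, y) - px (c1, k + y)) * h - (py (x, y) - py (x, c2)) * k.
     rewrite /L /= -[p _]/(p (h + x, k + y)).
     rewrite -[p (h + x, k + y)](subrK (p (x, k + y))) E1.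
     rewrite -[p (x, k + y)](subrK (p (x, y))) E2; ring.
  have H1 : `|px (x, y) - px (c1, k + y)| <= e%:num / 2.
    apply/ltW/B1; split => /=; rewrite /ball /= distrC.
      by apply: le_lt_trans c1P _; rewrite addrK.
    by rewrite addrK.
  have H2 : `|py (x, y) - py (x, c2)| <= e%:num / 2.
    apply/ltW/B2; split => /=; rewrite /ball /=; first by rewrite subrr normr0.
    by rewrite distrC; apply: le_lt_trans c2P _; rewrite addrK.
  apply: le_trans (ler_normB _ _) _.
  rewrite !normrM normrN [e%:num]splitr mulrDl.
  apply: lerD; apply: ler_pM => //; by rewrite le_max lexx ?orbT.
Unshelve. all: by end_near.
Qed.

Lemma C1_chain p px py (a b : R -> R) (da db t : R) :
  (forall z, is_derive z (1, 0) p (px z)) ->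
  (forall z, is_derive z (0, 1) p (py z)) ->
  continuous px -> continuous py ->
  is_derive t 1 a da -> is_derive t 1 b db ->
  is_derive t 1 (fun t => p (a t, b t)) (px (a t, b t) * da + py (a t, b t) * db).
Proof.
move=> dx dy cx cy [dra va] [drb vb].
have pd := C1_is_diff dx dy cx cy (a t, b t).
have /derivable1_diffP ad := dra.
have /derivable1_diffP bd := drb.
have pairD : differentiable (fun s => (a s, b s)) t by exact: differentiable_pair.
constructor.
  apply/derivable1_diffP.
  by apply: (@differentiable_comp _ _ _ _ (fun s => (a s, b s)) p).
rewrite deriveE; last first.
  by apply: (@differentiable_comp _ _ _ _ (fun s => (a s, b s)) p).
rewrite (@diff_comp _ _ _ _ (fun s => (a s, b s)) p)//=.
rewrite diff_val /= diff_pair//=.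
by rewrite -deriveE// -deriveE// va vb.
Qed.

End PlaneCalculus.

(** * Mean values over circles and the maximum principle *)

Section IntegralsOverSegments.
Variable R : realType.
Notation mu := (@lebesgue_measure R).

Lemma continuous_segment_integrable (f : R -> R) (a b : R) :
  continuous f -> mu.-integrable `[a, b] (EFin \o f).
Proof.
move=> cf; apply: continuous_compact_integrable; first exact: segment_compact.
exact: continuous_subspaceT.
Qed.

(** Continuity of [df] on a compact rectangle provides the constant that
    dominates the difference quotients. *)
Lemma is_derive_Rintegral (f df : R -> R -> R) (a b s : R) :
  (forall s t : R, is_derive s 1 (f^~ t) (df s t)) ->
  continuous (fun z : R * R => df z.1 z.2) -> (forall s, continuous (f s)) ->
  is_derive s 1 (fun s => \int[mu]_(t in `[a, b]) f s t)
    (\int[mu]_(t in `[a, b]) df s t).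
Proof.
move=> dfE cdf cf.
pose K : set (R * R) := `[s - 1, s + 1] `*` `[a, b].
have Kc : compact K by apply: compact_setX; exact: segment_compact.
have [M MP] : exists M : R, forall z, K z -> `|df z.1 z.2| <= M.
  have [->|K0] := eqVneq K set0; first by exists 0.
  have cn : {within K, continuous (fun z => `|df z.1 z.2|)}.
    apply: continuous_subspaceT => z; apply: continuous_comp; first exact: cdf.
    exact: norm_continuous.
  have [c _ cP] := compact_EVT_max (iffLR (set0P _) K0) Kc cn.
  by exists `|df c.1 c.2| => z /mem_set/cP.
have M1 : forall t : R, 0 <= Num.max 0 M by move=> t; rewrite le_max lexx.
have dom : forall (x : R) t, `]s - 1, s + 1[%classic x -> `[a, b]%classic t ->
    `|partial1of2 f x t| <= Num.max 0 M.
  move=> x t xI tI; rewrite partial1of2E (@derive_val _ _ _ _ _ _ _ (dfE x t)).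
  rewrite le_max; apply/orP; right; apply: (MP (x, t)); split=> //=.
  by move: xI; rewrite /= !in_itv/= => /andP[/ltW-> /ltW->].
have ss : `]s - 1, s + 1[%classic s.
  by rewrite /= in_itv/= ltrBlDr ltrDl ltr01.
have ints x : `]s - 1, s + 1[%classic x -> mu.-integrable `[a, b] (EFin \o f x).
  by move=> _; exact: continuous_segment_integrable.
have intM : mu.-integrable `[a, b] (EFin \o (fun=> Num.max 0 M)).
  by apply: continuous_segment_integrable; exact: cst_continuous.
have der x t : `]s - 1, s + 1[%classic x -> `[a, b]%classic t ->
    derivable (f ^~ t) x 1 by move=> _ _; have [] := dfE x t.
have m : measurable (`[a, b]%classic : set R) by exact: measurable_itv.
constructor.
  exact: (@derivable_under_integral R _ _ mu f _ m s _ _ ss ints der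
    (fun=> Num.max 0 M) M1 intM dom).
rewrite -derive1E (@differentiation_under_integral R _ _ mu f _ m s _ _ ss ints der
  (fun=> Num.max 0 M) M1 intM dom).
apply: eq_Rintegral => t _; rewrite partial1of2E.
exact: (@derive_val _ _ _ _ _ _ _ (dfE s t)).
Qed.

Lemma Rintegral_derive (F f : R -> R) (a b : R) : a < b ->
  (forall t : R, is_derive t 1 F (f t)) -> continuous f ->
  \int[mu]_(t in `[a, b]) f t = F b - F a.
Proof.
move=> ab dF cf; rewrite /Rintegral (@continuous_FTC2 _ f F)//.
- exact: continuous_subspaceT.
- have cF : continuous F.
    move=> t; apply: differentiable_continuous; apply/derivable1_diffP.
    by have [] := dF t.
  split => [t _||]; first by have [] := dF t.
  + exact/cvg_at_right_filter/cF.
  + exact/cvg_at_left_filter/cF.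
- by move=> t _; rewrite derive1E; exact: (@derive_val _ _ _ _ _ _ _ (dF t)).
Qed.

(** The primitive of [f] is nondecreasing with equal values at both ends, so
    it vanishes, and with it its derivative [f]. *)
Lemma Rintegral_ge0_eq0 (f : R -> R) (a b c : R) :
  (forall t, 0 <= f t) -> continuous f -> \int[mu]_(t in `[a, b]) f t = 0 ->
  a < c < b -> f c = 0.
Proof.
move=> f0 cf int0 /andP[ac cb].
pose F x := \int[mu]_(t in `[a, x]) f t.
have ib x : mu.-integrable `[a, x] (EFin \o f) by exact: continuous_segment_integrable.
have Fmono x y : a <= x -> x <= y -> F x <= F y.
  move=> ax xy; rewrite -subr_ge0 /F.
  rewrite (@Rintegral_itvB _ f (BLeft a) (BRight y) x (ib y)) ?bnd_simp//.
  by apply: Rintegral_ge0.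
have F0 x : a <= x -> 0 <= F x by move=> ax; apply: Rintegral_ge0.
have Fz x : x \in `]a, b[ -> F x = 0.
  rewrite in_itv/= => /andP[ax xb]; apply/eqP; rewrite eq_le F0 ?(ltW ax)// andbT.
  by rewrite -int0; apply: Fmono; exact: ltW.
have [dF <-] : derivable F c 1 /\ F^`()%classic c = f c.
  by apply: (@continuous_FTC1 R f (BLeft a) c b cb (ib b)); [rewrite lte_fin|exact: cf].
have FE : \near c, F c = (cst 0 : R -> R) c.
  by near=> x; apply: Fz; near: x; apply: near_in_itvoo; rewrite in_itv/= ac cb.
by rewrite derive1E (near_eq_derive (1 : R) FE) derive_cst.
Unshelve. all: by end_near.
Qed.

End IntegralsOverSegments.

Section MaximumPrinciple.
Variable R : realType.
Notation mu := (@lebesgue_measure R).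
Variables p q px py : R * R -> R.
Hypothesis dpx : forall z : R * R, is_derive z (1, 0) p (px z).
Hypothesis dpy : forall z : R * R, is_derive z (0, 1) p (py z).
Hypothesis dqx : forall z : R * R, is_derive z (1, 0) q (- py z).
Hypothesis dqy : forall z : R * R, is_derive z (0, 1) q (px z).
Hypothesis cpx : continuous px.
Hypothesis cpy : continuous py.

(** By the Cauchy-Riemann equations [s] times the derivative of [p] along the
    radius of a circle of radius proportional to [s] is the derivative of [q]
    along the circle, which has mean zero. So the mean of [p] over the circle
    centred at [z0] through any given point does not depend on [s] and equals
    the maximum [p z0]; then [p] is equal to [p z0] on the circle. *)
Lemma harmonic_max (z0 : R * R) : (forall z, p z <= p z0) -> forall z, p z = p z0.
Proof.
case: z0 => x y pmax [x1 y1]; pose u := x1 - x; pose v := y1 - y.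
have cpy' : continuous (fun z => - py z) by move=> z; apply: cvgN; exact: cpy.
have cp : continuous p.
  move=> z; apply: differentiable_continuous.
  by have [] := C1_is_diff dpx dpy cpx cpy z.
(* The given point is at parameter [s = 1] and angle [t = 0]; angles range over
   [- pi, pi] so that it lies in the interior of the interval. *)
pose xt t := u * cos t - v * sin t; pose yt t := v * cos t + u * sin t.
pose xs s t := x + s * xt t; pose ys s t := y + s * yt t.
have cos2 : continuous (fun z : R * R => cos z.2).
  by move=> z; apply: (@continuous_comp _ _ _ snd cos); [exact: cvg_snd|exact: continuous_cos].
have sin2 : continuous (fun z : R * R => sin z.2).
  by move=> z; apply: (@continuous_comp _ _ _ snd sin); [exact: cvg_snd|exact: continuous_sin].
have cxt : continuous (fun z : R * R => xt z.2).
  move=> z; apply: cvgB; (apply: cvgM; first exact: cvg_cst).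
    exact: cos2.
  exact: sin2.
have cyt : continuous (fun z : R * R => yt z.2).
  move=> z; apply: cvgD; (apply: cvgM; first exact: cvg_cst).
    exact: cos2.
  exact: sin2.
have cxs : continuous (fun z : R * R => xs z.1 z.2).
  move=> z; apply: cvgD; first exact: cvg_cst.
  by apply: cvgM; [exact: cvg_fst|exact: cxt].
have cys : continuous (fun z : R * R => ys z.1 z.2).
  move=> z; apply: cvgD; first exact: cvg_cst.
  by apply: cvgM; [exact: cvg_fst|exact: cyt].
have cxys : continuous (fun z : R * R => (xs z.1 z.2, ys z.1 z.2)).
  by move=> z; exact: (cvg_pair (cxs z) (cys z)).
have inner (s : R) : continuous (fun t : R => (s, t)).
  move=> t; have c1 : (fun=> s : R) @ t --> s by exact: cvg_cst.
  have c2 : (fun t : R => t) @ t --> t by exact: cvg_id.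
  exact: (cvg_pair c1 c2).
have dxt (t : R) : is_derive t 1 xt (- yt t).
  by apply: is_derive_eq; rewrite /yt /GRing.scale/=; ring.
have dyt (t : R) : is_derive t 1 yt (xt t).
  by apply: is_derive_eq; rewrite /xt /GRing.scale/=; ring.
pose f s t := p (xs s t, ys s t).
pose df s t := px (xs s t, ys s t) * xt t + py (xs s t, ys s t) * yt t.
have cf s : continuous (f s).
  move=> t; apply: (@continuous_comp _ _ _ (fun t => (s, t)) (fun z => f z.1 z.2)); first exact: inner.
  by apply: (@continuous_comp _ _ _ _ p); [exact: cxys|exact: cp].
have cdf : continuous (fun z : R * R => df z.1 z.2).
  move=> z; apply: cvgD; apply: cvgM.
  - by apply: (@continuous_comp _ _ _ _ px); [exact: cxys|exact: cpx].
  - exact: cxt.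
  - by apply: (@continuous_comp _ _ _ _ py); [exact: cxys|exact: cpy].
  - exact: cyt.
have dfE (s t : R) : is_derive s 1 (f^~ t) (df s t).
  apply: (C1_chain dpx dpy cpx cpy); apply: is_derive_eq;
    by rewrite /GRing.scale/= /xt /yt; ring.
have dgE (s t : R) : is_derive t 1 (fun t => q (xs s t, ys s t)) (s * df s t).
  apply: is_derive_eq.
    apply: (C1_chain dqx dqy cpy' cpx).
  by rewrite /GRing.scale/= /df; ring.
pose Phi s := \int[mu]_(t in `[- pi, pi]) f s t.
have pi_gt : - pi < pi :> R by rewrite gt0_cp ?pi_gt0.
have dPhi (s : R) : s != 0 -> is_derive s 1 Phi 0.
  move=> s0; have := is_derive_Rintegral (- pi) pi s dfE cdf cf.
  suff -> : \int[mu]_(t in `[- pi, pi]) df s t = 0 by [].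
  apply: (mulfI s0); rewrite mulr0 -RintegralZl//; last first.
    apply: continuous_segment_integrable => t.
    by apply: (@continuous_comp _ _ _ (fun t => (s, t)) (fun z => df z.1 z.2)); [exact: inner|exact: cdf].
  rewrite (Rintegral_derive pi_gt (dgE s)).
    by rewrite /xs /ys /xt /yt !cosN !sinN sinpi oppr0 subrr.
  move=> t; apply: cvgM; first exact: cvg_cst.
  by apply: (@continuous_comp _ _ _ (fun t => (s, t)) (fun z => df z.1 z.2)); [exact: inner|exact: cdf].
have Phi01 : Phi 1 = Phi 0.
  have dP (s : R) := is_derive_Rintegral (- pi) pi s dfE cdf cf.
  have cPhi : continuous Phi.
    move=> s; apply: differentiable_continuous; apply/derivable1_diffP.
    by have [] := dP s.
  have [c] := MVT ltr01 (fun s _ => dP s) (continuous_subspaceT cPhi).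
  rewrite in_itv/= => /andP[c0 _].
  have [_ <-] := dP c; have [_ ->] := dPhi c (lt0r_neq0 c0).
  by rewrite mul0r => /eqP; rewrite subr_eq0 => /eqP.
have cg : continuous (fun t => p (x, y) - f 1 t).
  by move=> t; apply: cvgB; [exact: cvg_cst|exact: cf].
have := @Rintegral_ge0_eq0 _ (fun t => p (x, y) - f 1 t) (- pi) pi 0 _ cg.
rewrite /f /xs /ys /xt /yt cos0 sin0 !mulr1 !mulr0 addr0 subr0 !mul1r.
rewrite /u /v !(addrC _ (_ - _)) !subrK => H; apply/esym/eqP; rewrite -subr_eq0.
apply/eqP/H => [t||]; first by rewrite subr_ge0.
- rewrite RintegralB//=; last 2 first.
  + by apply: continuous_segment_integrable; exact: cst_continuous.
  + exact: continuous_segment_integrable (cf 1).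
  rewrite -[X in _ - X]/(Phi 1) Phi01 -RintegralB//=; last 2 first.
  + by apply: continuous_segment_integrable; exact: cst_continuous.
  + exact: continuous_segment_integrable (cf 0).
  have E0 : {in `[- pi, pi]%classic, (fun t => p (x, y) - f 0 t) =1 cst 0}.
    by move=> t _; rewrite /f /xs /ys !mul0r !addr0 subrr.
  by rewrite (@eq_Rintegral _ _ _ mu _ _ _ E0) Rintegral_cst ?mul0r.
- by rewrite oppr_lt0 pi_gt0.
Qed.

End MaximumPrinciple.

(** * Quaternion algebra *)

Section QuaternionAlgebra.
Variable R : realType.
Implicit Types (p q r e I : quat R) (x y a : R).

Lemma qreM p q : qre (p * q) =
  qre p * qre q - qi p * qi q - qj p * qj q - qk p * qk q.
Proof. exact: qre_mk. Qed.
Lemma qiM p q : qi (p * q) =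
  qre p * qi q + qi p * qre q + qj p * qk q - qk p * qj q.
Proof. exact: qi_mk. Qed.
Lemma qjM p q : qj (p * q) =
  qre p * qj q - qi p * qk q + qj p * qre q + qk p * qi q.
Proof. exact: qj_mk. Qed.
Lemma qkM p q : qk (p * q) =
  qre p * qk q + qi p * qj q - qj p * qi q + qk p * qre q.
Proof. exact: qk_mk. Qed.
Definition quatME := (qreM, qiM, qjM, qkM).

Lemma qreN q : qre (- q) = - qre q. Proof. by rewrite /qre mxE. Qed.
Lemma qiN q : qi (- q) = - qi q. Proof. by rewrite /qi mxE. Qed.
Lemma qjN q : qj (- q) = - qj q. Proof. by rewrite /qj mxE. Qed.
Lemma qkN q : qk (- q) = - qk q. Proof. by rewrite /qk mxE. Qed.
Definition quatNE := (qreN, qiN, qjN, qkN).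

Lemma qre0 : qre (0 : quat R) = 0. Proof. by rewrite /qre mxE. Qed.
Lemma qi0 : qi (0 : quat R) = 0. Proof. by rewrite /qi mxE. Qed.
Lemma qj0 : qj (0 : quat R) = 0. Proof. by rewrite /qj mxE. Qed.
Lemma qk0 : qk (0 : quat R) = 0. Proof. by rewrite /qk mxE. Qed.
Lemma qre1 : qre (1 : quat R) = 1. Proof. exact: qre_mk. Qed.
Lemma qi1 : qi (1 : quat R) = 0. Proof. exact: qi_mk. Qed.
Lemma qj1 : qj (1 : quat R) = 0. Proof. exact: qj_mk. Qed.
Lemma qk1 : qk (1 : quat R) = 0. Proof. exact: qk_mk. Qed.
Definition quatCE := (qre0, qi0, qj0, qk0, qre1, qi1, qj1, qk1).

Definition quatE := (quatCE, quatME, quatNE, @quatDE R, @quatZE R, @quat_mkE R).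

Definition qconj q : quat R := mkquat (qre q) (- qi q) (- qj q) (- qk q).

Lemma qdotE p q :
  qdot p q = qre p * qre q + qi p * qi q + qj p * qj q + qk p * qk q.
Proof.
rewrite /qdot /qre /qi /qj /qk !big_ord_recl big_ord0 addr0 !addrA.
by congr (p _ _ * q _ _ + p _ _ * q _ _ + p _ _ * q _ _ + p _ _ * q _ _);
  apply/val_inj; rewrite /= inordK.
Qed.

Definition qnormsq q : R := qdot q q.

Lemma qnormsqE q : qnormsq q = qre q ^+ 2 + qi q ^+ 2 + qj q ^+ 2 + qk q ^+ 2.
Proof. by rewrite /qnormsq qdotE !expr2. Qed.

Lemma qdotC p q : qdot p q = qdot q p.
Proof. by rewrite !qdotE; ring. Qed.
Lemma qdotDl p q r : qdot (p + q) r = qdot p r + qdot q r.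
Proof. by rewrite !qdotE !quatE; ring. Qed.
Lemma qdotZl a p q : qdot (a *: p) q = a * qdot p q.
Proof. by rewrite !qdotE !quatE; ring. Qed.
Lemma qdotNl p q : qdot (- p) q = - qdot p q.
Proof. by rewrite !qdotE !quatE; ring. Qed.
Lemma qdotNr p q : qdot p (- q) = - qdot p q.
Proof. by rewrite !qdotE !quatE; ring. Qed.

Lemma qnormsq_ge0 q : 0 <= qnormsq q.
Proof. by rewrite qnormsqE !addr_ge0 ?sqr_ge0. Qed.

Lemma qnormsq_eq0 q : (qnormsq q == 0) = (q == 0).
Proof.
apply/eqP/eqP => [|->]; last by rewrite qnormsqE !quatE; ring.
rewrite qnormsqE => /eqP; rewrite !paddr_eq0 ?addr_ge0 ?sqr_ge0// !sqrf_eq0.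
move=> /andP[/andP[/andP[/eqP h0 /eqP h1] /eqP h2] /eqP h3].
by apply: quatP; rewrite !quatE.
Qed.

Lemma qnormsq_gt0 q : (0 < qnormsq q) = (q != 0).
Proof. by rewrite lt0r qnormsq_ge0 andbT qnormsq_eq0. Qed.

Lemma qnormsqM p q : qnormsq (p * q) = qnormsq p * qnormsq q.
Proof. by rewrite !qnormsqE !quatE; ring. Qed.
Lemma qnormsqZ a q : qnormsq (a *: q) = a ^+ 2 * qnormsq q.
Proof. by rewrite !qnormsqE !quatE; ring. Qed.
Lemma qnormsqN q : qnormsq (- q) = qnormsq q.
Proof. by rewrite !qnormsqE !quatE; ring. Qed.
Lemma qnormsq1 : qnormsq 1 = 1.
Proof. by rewrite qnormsqE !quatE; ring. Qed.
Lemma qnormsqA a : qnormsq a%:A = a ^+ 2.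
Proof. by rewrite qnormsqZ qnormsq1 mulr1. Qed.

Lemma qmul_conj q : q * qconj q = (qnormsq q)%:A.
Proof. by apply: quatP; rewrite qnormsqE /qconj !quatE; ring. Qed.
Lemma qconj_mul q : qconj q * q = (qnormsq q)%:A.
Proof. by apply: quatP; rewrite qnormsqE /qconj !quatE; ring. Qed.

Definition qinv q : quat R := (qnormsq q)^-1 *: qconj q.

Lemma qmulV q : q != 0 -> q * qinv q = 1.
Proof.
rewrite -qnormsq_eq0 => q0.
by rewrite /qinv -scalerAr qmul_conj scalerA mulVf// scale1r.
Qed.
Lemma qmulVl q : q != 0 -> qinv q * q = 1.
Proof.
rewrite -qnormsq_eq0 => q0.
by rewrite /qinv -scalerAl qconj_mul scalerA mulVf// scale1r.
Qed.

Lemma qmul_eq0 p q : (p * q == 0) = (p == 0) || (q == 0).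
Proof. by rewrite -!qnormsq_eq0 qnormsqM mulf_eq0. Qed.

Lemma qmulIr q : q != 0 -> injective (fun p => p * q).
Proof.
move=> q0 p r /eqP; rewrite -subr_eq0 -mulrBl qmul_eq0 (negPf q0) orbF.
by rewrite subr_eq0 => /eqP.
Qed.

Lemma qnorm_eq1 q : qnorm q = 1 <-> qnormsq q = 1.
Proof.
rewrite /qnorm -/(qnormsq q); split=> [|->]; last exact: sqrtr1.
by move=> h; rewrite -[qnormsq q]sqr_sqrtr ?qnormsq_ge0// h expr1n.
Qed.

Lemma qnorm_ge1 q : (1 <= qnorm q) = (1 <= qnormsq q).
Proof.
by rewrite /qnorm -/(qnormsq q) -[X in (X <= Num.sqrt _)]sqrtr1 ler_sqrt ?qnormsq_ge0.
Qed.

(** Squaring [I] gives [2 qre I *: I] up to a real number, so [I ^+ 2 = -1]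
    forces either [qre I = 0] or a real square root of [-1]. *)
Lemma imag_unitE I : I ^+ 2 = -1 <-> qre I = 0 /\ qnormsq I = 1.
Proof.
rewrite expr2 qnormsqE; split=> [h|[h0 h1]]; last first.
  apply: quatP; rewrite !quatE h0; try ring.
  by rewrite -h1 h0; ring.
have := congr1 (@qre R) h; have := congr1 (@qi R) h.
have := congr1 (@qj R) h; have := congr1 (@qk R) h.
rewrite !quatE oppr0 => hk hj hi hr.
have E0 (x : R) : qre I * x + x * qre I = 0 -> qre I = 0 \/ x = 0.
  move=> /eqP; rewrite [x * _]mulrC -mulr2n mulrn_eq0/= mulf_eq0.
  by move=> /orP[/eqP|/eqP]; [left|right].
have hi' : qre I * qi I + qi I * qre I = 0 by rewrite -hi; ring.
have hj' : qre I * qj I + qj I * qre I = 0 by rewrite -hj; ring.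
have hk' : qre I * qk I + qk I * qre I = 0 by rewrite -hk; ring.
have h0 : qre I = 0.
  case: (E0 _ hi') => // i0; case: (E0 _ hj') => // j0; case: (E0 _ hk') => // k0.
  exfalso; move: hr; rewrite i0 j0 k0 !mulr0 !subr0 -expr2 => h2.
  by have := sqr_ge0 (qre I); rewrite h2 ler0N1.
by split=> //; move: hr; rewrite h0 => hr; lra.
Qed.

(** The slice is spanned by the normalized imaginary part of [q]; for a real
    [q] any slice will do. *)
Lemma slice_decomposition q :
  exists I x y, I ^+ 2 = -1 /\ q = x%:A + y *: I.
Proof.
pose v : quat R := mkquat 0 (qi q) (qj q) (qk q).
have qv : q = (qre q)%:A + v by apply: quatP; rewrite /v !quatE; ring.
have [v0|v0] := eqVneq v 0.
  exists (mkquat 0 1 0 0), (qre q), 0; split=> //.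
    by apply/imag_unitE; rewrite qnormsqE !quatE; split=> //; ring.
  by rewrite {1}qv v0 scale0r.
have Nv : 0 < qnormsq v by rewrite qnormsq_gt0.
have sv : 0 < Num.sqrt (qnormsq v) by rewrite sqrtr_gt0.
exists ((Num.sqrt (qnormsq v))^-1 *: v), (qre q), (Num.sqrt (qnormsq v)).
split.
  apply/imag_unitE; split; first by rewrite !quatE mulr0.
  by rewrite qnormsqZ exprVn sqr_sqrtr ?ltW// mulVf ?gt_eqF.
by rewrite scalerA divff ?gt_eqF// scale1r.
Qed.

Lemma norm_coord q : [/\ `|qre q| <= `|q|, `|qi q| <= `|q|, `|qj q| <= `|q| &
  `|qk q| <= `|q|].
Proof.
have H i : `|q ord0 i| <= `|q|.
  rewrite [leRHS](mx_normrE (q : 'rV_4)).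
  exact: (le_bigmax _ (fun x : 'I_1 * 'I_4 => `|q x.1 x.2|) (ord0, i)).
by split; exact: H.
Qed.

Lemma norm_le q a : `|qre q| <= a -> `|qi q| <= a -> `|qj q| <= a ->
  `|qk q| <= a -> `|q| <= a.
Proof.
move=> h0 h1 h2 h3; rewrite [leLHS](mx_normrE (q : 'rV_4)).
apply/bigmax_leP; split=> [|[i j] _ /=]; first exact: le_trans (normr_ge0 _) h0.
have -> : i = ord0 by apply/val_inj; case: i => -[].
by case: j => [[|[|[|[|//]]]] lti]; rewrite -[Ordinal lti]inord_val.
Qed.

(** Each coordinate of a product is a sum of four products of coordinates. *)
Lemma norm_qmul p q : `|p * q| <= 4 * (`|p| * `|q|).
Proof.
have [p0 p1 p2 p3] := norm_coord p; have [q0 q1 q2 q3] := norm_coord q.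
have B x y z t : `|x| <= `|p| * `|q| -> `|y| <= `|p| * `|q| ->
    `|z| <= `|p| * `|q| -> `|t| <= `|p| * `|q| ->
    `|x + y + z + t| <= 4 * (`|p| * `|q|).
  move=> hx hy hz ht; apply: le_trans (ler_normD _ _) _.
  have := ler_normD (x + y) z; have := ler_normD x y; lra.
by apply: norm_le; rewrite !quatE; apply: B; rewrite ?normrN normrM; exact: ler_pM.
Qed.

End QuaternionAlgebra.

(** * Lattices *)

Section LatticeGeometry.
Variable R : realType.
Implicit Types (p q : quat R) (L : lattice R).

Section MembershipClosure.
Variable L : lattice R.

Lemma latP q : reflect (lat_set L q) (q \in lat_pred L).
Proof. exact: asboolP. Qed.
Lemma lat0 : lat_set L 0. Proof. by apply/latP; exact: rpred0. Qed.
Lemma latD p q : lat_set L p -> lat_set L q -> lat_set L (p + q).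
Proof. by move=> /latP Lp /latP Lq; apply/latP; exact: rpredD. Qed.
Lemma latN q : lat_set L q -> lat_set L (- q).
Proof. by move=> /latP Lq; apply/latP; rewrite rpredN. Qed.
Lemma latB p q : lat_set L p -> lat_set L q -> lat_set L (p - q).
Proof. by move=> Lp Lq; apply: latD => //; exact: latN. Qed.
Lemma lat_mulz q (n : int) : lat_set L q -> lat_set L (q *~ n).
Proof. by move=> /latP Lq; apply/latP; exact: rpredMz. Qed.

Lemma torus_proj_eq p q :
  torus_proj L p = torus_proj L q <-> lat_set L (p - q).
Proof.
split=> [h|/latP].
  by apply/latP; rewrite Quotient.idealrBE; apply/eqP; exact: h.
by rewrite Quotient.idealrBE => /eqP h; exact: h.
Qed.

End MembershipClosure.

Lemma coord_bounded (v : 4.-tuple (quat R)) :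
  exists2 C, 0 < C & forall i q, `|coord v i q| <= C * `|q|.
Proof.
pose e0 : quat R := mkquat 1 0 0 0; pose e1 : quat R := mkquat 0 1 0 0.
pose e2 : quat R := mkquat 0 0 1 0; pose e3 : quat R := mkquat 0 0 0 1.
pose c i := `|coord v i e0| + `|coord v i e1| + `|coord v i e2| + `|coord v i e3|.
have c0 i : 0 <= c i by rewrite !addr_ge0.
exists (1 + \sum_i c i); first by rewrite ltr_pwDl// sumr_ge0.
move=> i q; apply: (@le_trans _ _ (c i * `|q|)); last first.
  rewrite ler_wpM2r// (bigD1 i)//= addrA addrC -subr_ge0 -addrA.
  by rewrite [X in _ + X](_ : _ = 1) ?addr_ge0// ?sumr_ge0//; ring.
have -> : q = qre q *: e0 + qi q *: e1 + qj q *: e2 + qk q *: e3.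
  by apply: quatP; rewrite !quatE; ring.
set x := (X in _ * `|X|).
have [h0 h1 h2 h3] := norm_coord q.
have xq : x = q by apply: quatP; rewrite /x !quatE; ring.
rewrite {}xq !linearD !linearZ/= /c !mulrDl.
have B a b (d : R) : `|a| <= d -> `|a * b| <= `|b| * d.
  by move=> ad; rewrite normrM mulrC ler_wpM2l.
do 3 (apply: le_trans (ler_normD _ _) _; apply: lerD; last exact: B).
exact: B.
Qed.

Section FreeTuple.
Variables (v : 4.-tuple (quat R)) (vf : free v).

Lemma quat_coord q : q = \sum_i coord v i q *: tnth v i.
Proof.
have vb : basis_of fullv v.
  by rewrite basisEfree vf subvf dimvf size_tuple.
rewrite {1}(coord_basis vb (memvf q)); apply: eq_bigr => i _.
by rewrite (tnth_nth 0).
Qed.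

Lemma coord_zsum (n : 'I_4 -> int) i :
  coord v i (\sum_j tnth v j *~ n j) = (n i)%:~R.
Proof.
under eq_bigr => j _ do rewrite -scaler_int (tnth_nth 0).
exact: coord_sum_free.
Qed.

End FreeTuple.

(** The coordinates of a lattice vector are integers, and they are bounded by
    its norm. *)
Lemma lattice_discrete L :
  exists2 c, 0 < c & forall l, lat_set L l -> `|l| < c -> l = 0.
Proof.
have [v [vf ->]] := lat_basis L; have [C C0 CP] := coord_bounded v.
exists C^-1; first by rewrite invr_gt0.
move=> _ [n ->] small; apply: big1 => i _.
suff -> : n i = 0 by rewrite mulr0z.
have := CP i (\sum_j tnth v j *~ n j); rewrite coord_zsum// => h.
have : `|(n i)%:~R : R| < 1.
  apply: le_lt_trans h _; rewrite -(mulfV (lt0r_neq0 C0)) ltr_pM2l//.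
rewrite -intr_norm ltrz1; lia.
Qed.

(** Subtracting the integer parts of the coordinates leads to a bounded
    parallelepiped. *)
Lemma lattice_cocompact L :
  exists B, forall q, exists2 d, `|d| <= B & lat_set L (q - d).
Proof.
have [v [vf ->]] := lat_basis L.
exists (\sum_i `|tnth v i|) => q.
pose f i := Num.floor (coord v i q).
exists (\sum_i (coord v i q - (f i)%:~R) *: tnth v i); last first.
  exists f; rewrite {1}(quat_coord vf q) -sumrB; apply: eq_bigr => i _.
  by rewrite scalerBl opprB addrC subrK scaler_int.
apply: le_trans (ler_norm_sum _ _ _) _; apply: ler_sum => i _.
rewrite normrZ ler_piMl// ger0_norm ?subr_ge0 ?ge_floor//.
by rewrite lerBlDl; have /ltW := floorD1_gt (coord v i q); rewrite intrD.
Qed.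

Lemma norm_le_sqrt q : `|q| <= Num.sqrt (qnormsq q).
Proof.
apply: norm_le; rewrite -sqrtr_sqr ler_sqrt ?qnormsq_ge0// qnormsqE;
  have := sqr_ge0 (qre q); have := sqr_ge0 (qi q); have := sqr_ge0 (qj q);
  have := sqr_ge0 (qk q); lra.
Qed.

(** Lattice vectors of bounded length are finite in number, so the minimum is
    attained. *)
Lemma lattice_shortest L (P : quat R -> Prop) :
  (exists2 q, lat_set L q & P q) ->
  exists q, [/\ lat_set L q, P q &
    forall q', lat_set L q' -> P q' -> qnormsq q <= qnormsq q'].
Proof.
move=> [q1 Lq1 Pq1].
have [v [vf Lv]] := lat_basis L; have [C C0 CP] := coord_bounded v.
pose B := C * Num.sqrt (qnormsq q1).
pose N := Num.bound B.
(* Coefficients between [- N] and [N] are indexed by the ordinals up to [2 N]. *)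
pose vec (k : {ffun 'I_4 -> 'I_(N.*2.+1)}) : quat R :=
  \sum_i tnth v i *~ ((k i)%:Z - N%:Z).
have Lvec k : lat_set L (vec k) by rewrite Lv; exists (fun i => (k i)%:Z - N%:Z).
have vecP q : lat_set L q -> qnormsq q <= qnormsq q1 -> exists k, q = vec k.
  rewrite Lv => -[n qE] qle.
  have nB i : (`|n i| <= N)%N.
    have h : `|(n i)%:~R : R| < N%:R.
      rewrite -(coord_zsum vf) -qE; apply: le_lt_trans (CP i q) _.
      apply: (@le_lt_trans _ _ B).
        rewrite /B ler_pM2l//; apply: le_trans (norm_le_sqrt q) _.
        by rewrite ler_sqrt ?qnormsq_ge0.
      by apply: archi_boundP; rewrite /B mulr_ge0 ?sqrtr_ge0// ltW.
    by move: h; rewrite -intr_norm -[N%:R]/(N%:Z%:~R) ltr_int; lia.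
  exists [ffun i => inord (absz (n i + N%:Z))]; rewrite qE; apply: eq_bigr => i _.
  congr (_ *~ _); rewrite ffunE inordK; have := nB i; lia.
have [k1 k1E] := vecP q1 Lq1 (lexx _).
pose S := [pred k | `[< P (vec k) >]].
have S1 : S k1 by apply/asboolP; rewrite -k1E.
have [k /asboolP Pk kmin] := @arg_minP _ R _ k1 S (fun k => qnormsq (vec k)) S1.
exists (vec k); split=> // q' Lq' Pq'.
have [/(vecP _ Lq')[k' k'E]|] := leP (qnormsq q') (qnormsq q1).
  by rewrite k'E; apply: kmin; apply/asboolP; rewrite -k'E.
by move=> /ltW; apply: le_trans; rewrite k1E; exact: kmin.
Qed.

End LatticeGeometry.

(** * Local lifts of maps between tori *)

Section TorusTopology.
Variable R : realType.
Implicit Types (p q : quat R) (L : lattice R).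

Lemma proj_continuous L : continuous (torus_proj L).
Proof. exact: pi_continuous. Qed.

(** The saturation of [U] is the union of its translates by [L]. *)
Lemma proj_open L (U : set (quat R)) : open U -> open (torus_proj L @` U).
Proof.
rewrite !openE => Uo.
suff : open (torus_proj L @^-1` (torus_proj L @` U)) by rewrite -openE.
rewrite openE => q /= [u Uu uq].
have Lqu : lat_set L (q - u) by apply/torus_proj_eq.
have nU : nbhs u U by exact: Uo.
rewrite /interior.
have c : (fun w : quat R => w - (q - u)) @ q --> u.
  rewrite -[X in _ --> X](subKr q u).
  have c1 : (fun w : quat R => w) @ q --> q by exact: cvg_id.
  exact: (cvgB c1 (cvg_cst _)).
have nq : nbhs q ((fun w : quat R => w - (q - u)) @^-1` U) by exact: c.
apply: filterS nq => w Uw; exists (w - (q - u)) => //.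
by apply/torus_proj_eq; rewrite addrC addKr; exact: latN.
Qed.

(** A ball is the union of the segments issued from its centre. *)
Lemma connected_ball (q : quat R) (r : R) : 0 < r -> connected (ball q r).
Proof.
move=> r0.
have -> : ball q r = \bigcup_(p in ball q r)
    ((fun t : R => q + t *: (p - q)) @` `[0, 1]).
  apply/seteqP; split=> [p qp|_ [p + [t + <-]]].
    exists p => //; exists 1; first by rewrite /= in_itv/= ler01 lexx.
    by rewrite scale1r addrC subrK.
  rewrite -ball_normE /= in_itv/= => qp /andP[t0 t1].
  rewrite opprD addNKr normrN normrZ ger0_norm//.
  apply: le_lt_trans qp; rewrite distrC.
  by rewrite ler_piMl.
apply: bigcup_connected => [|p _].
  exists q => p _; exists 0; first by rewrite /= in_itv/= lexx ler01.
  by rewrite scale0r addr0.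
apply: connected_continuous_connected; first exact: segment_connected.
apply: continuous_subspaceT => t; apply: cvgD; first exact: cvg_cst.
exact: scalel_continuous.
Qed.

Lemma chart_domain_ball L c (q : quat R) (r : R) :
  (forall l, lat_set L l -> `|l| < c -> l = 0) -> 0 < r -> r + r <= c ->
  chart_domain L (ball q r).
Proof.
move=> Lc r0 rc; split; [exact: ball_open|exact: connected_ball|].
move=> x y; rewrite !inE -ball_normE /= => qx qy /torus_proj_eq Lxy.
apply/eqP; rewrite -subr_eq0; apply/eqP/Lc => //.
apply: lt_le_trans rc; apply: le_lt_trans (ler_distD q _ _) _.
by rewrite distrC ltrD.
Qed.

Lemma chart_proj L V p : chart_domain L V -> V p -> chart V (torus_proj L p) = p.
Proof. by move=> [_ _ Vi] Vp; apply: pinvKV => //; rewrite inE. Qed.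

End TorusTopology.

Section LocalLifts.
Variable R : realType.
Variables (L L' : lattice R) (f : torus L -> torus L').
Hypothesis fr : regular_map f.
Implicit Types (p q k : quat R) (h : R).

(** A lift of [f] that need not be continuous, as it depends on a choice of
    representatives. It allows statements about [f] to be expressed in the
    covering space modulo [L']. *)
Definition rep_lift q : quat R := repr (f (torus_proj L q)).
Local Notation s := rep_lift.

Lemma proj_rep_lift q : torus_proj L' (s q) = f (torus_proj L q).
Proof. exact: reprK. Qed.

Lemma rep_lift_periodic p q : lat_set L (p - q) -> s p = s q.
Proof. by move=> /torus_proj_eq; rewrite /rep_lift => ->. Qed.

Variable c : R.
Hypothesis c_gt0 : 0 < c.
Hypothesis cP : forall l, lat_set L' l -> `|l| < c -> l = 0.

(** The lift is the expression of [f] in a chart whose image is the ball of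
    radius [e] at [rep_lift q0]. *)
Lemma local_lift q0 e : 0 < e -> e + e <= c -> exists U F,
  [/\ open U, U q0, slice_regular U F &
      forall p, U p -> `|F p - s q0| < e /\ lat_set L' (F p - s p)].
Proof.
move=> e0 ec; have [cL cL0 cLP] := lattice_discrete L.
have VV : chart_domain L (ball q0 (cL / 2)).
  by apply: chart_domain_ball cLP _ _; rewrite ?divr_gt0//; lra.
have VV' : chart_domain L' (ball (s q0) e) by exact: chart_domain_ball cP _ _.
have [fc /(_ _ _ VV VV')] := fr.
set U := (X in slice_regular X _); set F := (X in slice_regular _ X) => UF.
exists U, F; split=> //.
- apply: openI; first exact: ball_open.
  apply: open_comp; last by apply: proj_open; exact: ball_open.
  move=> q _; apply: continuous_comp; first exact: proj_continuous.
  exact: fc.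
- split; first by apply: ballxx; rewrite divr_gt0.
  exists (s q0); first exact: ballxx.
  exact: proj_rep_lift.
- move=> p [_ [v Vv vE]].
  have -> : F p = v by rewrite -[RHS](chart_proj VV' Vv) vE.
  split; first by move: Vv; rewrite -ball_normE /= distrC.
  by apply/torus_proj_eq; rewrite proj_rep_lift vE.
Qed.

Lemma rep_lift_continuous q0 e : 0 < e ->
  \forall p \near q0, exists2 k, `|k| < e & lat_set L' (s p - s q0 - k).
Proof.
move=> e0; pose e' := Num.min e (c / 2).
have e'0 : 0 < e' by rewrite lt_min e0 divr_gt0.
have [||U [F [Uo Uq _ UF]]] := @local_lift q0 e' => //.
  have : e' <= c / 2 by rewrite ge_min lexx orbT.
  by lra.
have nU : nbhs q0 U by exact: open_nbhs_nbhs.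
apply: filterS nU => p /UF[Fp Lp]; exists (F p - s q0).
  by apply: lt_le_trans Fp _; rewrite ge_min lexx.
by rewrite opprB subrKA -opprB; exact: latN.
Qed.

(** A lift with small oscillation is continuous, because its values are
    determined modulo the discrete group [L']. *)
Lemma lift_continuous (U : set (quat R)) F q0 e : open U -> U q0 ->
  3 * e <= c ->
  (forall p, U p -> `|F p - s q0| < e /\ lat_set L' (F p - s p)) ->
  {for q0, continuous F}.
Proof.
move=> Uo Uq ec UF; suff: F @ q0 --> F q0 by [].
apply/(@cvgrPdist_lt _ _ _ (nbhs q0)) => d d0.
have [Fq Lq] := UF _ Uq.
have e0 : 0 < e by exact: le_lt_trans Fq.
pose d' := Num.min d e.
have d'0 : 0 < d' by rewrite lt_min d0 e0.
have nU : nbhs q0 U by exact: open_nbhs_nbhs.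
near=> p.
have Up : U p by near: p.
have [k kd Lk] : exists2 k, `|k| < d' & lat_set L' (s p - s q0 - k).
  by near: p; exact: rep_lift_continuous.
have [Fp Lp] := UF _ Up.
suff -> : F q0 - F p = - k.
  by rewrite normrN; apply: lt_le_trans kd _; rewrite ge_min lexx.
apply/eqP; rewrite -addr_eq0; apply/eqP; apply: cP.
  rewrite (_ : _ + k = (F q0 - s q0) - (F p - s p) - (s p - s q0 - k)); last first.
    by rewrite !opprB !addrA; apply: quatP; rewrite !quatE; ring.
  by apply: latB => //; exact: latB.
rewrite (_ : _ + k = (F q0 - s q0) - (F p - s q0) + k); last first.
  by apply: quatP; rewrite !quatE; ring.
have ke : `|k| < e by apply: lt_le_trans kd _; rewrite ge_min lexx orbT.
have := ler_normD ((F q0 - s q0) - (F p - s q0)) k.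
have := ler_normB (F q0 - s q0) (F p - s q0); lra.
Unshelve. all: by end_near.
Qed.

End LocalLifts.

(** * Calculus of slice regular functions *)

Section DerivativeTransport.
Variable R : realType.

Lemma is_derive_linear (V W W' : normedModType R) (l : {linear W -> W'})
    (u : V -> W) (x v : V) (du : W) :
  continuous l -> is_derive x v u du -> is_derive x v (l \o u) (l du).
Proof.
move=> lc [dr vE].
have H : h^-1 *: (((l \o u) \o shift x) (h *: v) - (l \o u) x) @[h --> 0^'] --> l du.
  rewrite (_ : (fun h => _) =
      (l \o (fun h : R => h^-1 *: ((u \o shift x) (h *: v) - u x)))).
    apply: continuous_cvg; first exact: lc.
    by rewrite -vE; exact: dr.
  by apply/funext => h /=; rewrite linearZZ [l (_ - _)]linearB.
constructor; first by apply/cvg_ex; exists (l du).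
by apply/cvg_lim => //; exact: norm_hausdorff.
Qed.

Lemma derive_translate (V W : normedModType R) (u : V -> W) (x v b : V) :
  (derivable (fun y => u (y + b)) x v <-> derivable u (x + b) v) /\
  'D_v (fun y => u (y + b)) x = 'D_v u (x + b).
Proof.
rewrite /derivable /derive.
suff -> : (fun h : R => h^-1 *: (((fun y => u (y + b)) \o shift x) (h *: v) - u (x + b)))
  = (fun h : R => h^-1 *: ((u \o shift (x + b)) (h *: v) - u (x + b))) by [].
by apply/funext => h /=; rewrite addrA.
Qed.

End DerivativeTransport.

Section SliceRegularity.
Variable R : realType.
Implicit Types (p q w I : quat R) (U : set (quat R)) (F G : quat R -> quat R).

Definition slice_pt I (z : R * R) : quat R := z.1%:A + z.2 *: I.

Lemma slice_ptD I z (h : R) : slice_pt I (z + (h, 0)) = slice_pt I z + h%:A.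
Proof. by rewrite /slice_pt /= addr0 scalerDl addrAC. Qed.

Lemma slice_pt_continuous I : continuous (slice_pt I).
Proof.
move=> z; apply: cvgD.
  by apply: (@continuous_comp _ _ _ fst (fun x : R => x%:A : quat R));
    [exact: cvg_fst|exact: scalel_continuous].
by apply: (@continuous_comp _ _ _ snd (fun x : R => x *: I));
    [exact: cvg_snd|exact: scalel_continuous].
Qed.

Lemma near_slice_pt U I z : open U -> U (slice_pt I z) ->
  \forall z' \near z, U (slice_pt I z').
Proof.
move=> Uo Uz; apply: (@near_fun _ _ (slice_pt I) z U); first exact: slice_pt_continuous.
exact: open_nbhs_nbhs.
Qed.

(** The condition that [slice_regular] imposes at one point; it only depends
    on the germ of [u] at [z], which makes slice regularity a local notion. *)
Definition regular_at I (z : R * R) (u : R * R -> quat R) : Prop :=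
  [/\ derivable u z (1, 0) /\ derivable u z (0, 1),
      {for z, continuous ('D_(1, 0) u)} /\ {for z, continuous ('D_(0, 1) u)} &
      2^-1 *: ('D_(1, 0) u z + I * 'D_(0, 1) u z) = 0].

Lemma slice_regularP U F : slice_regular U F <->
  forall I z, I ^+ 2 = -1 -> U (slice_pt I z) -> regular_at I z (slice F I).
Proof. by split=> H; [move=> I z I2 Uz|move=> I I2 z Uz]; exact: H. Qed.

Lemma regular_at_near_eq I z (u u' : R * R -> quat R) :
  {near z, u =1 u'} -> regular_at I z u -> regular_at I z u'.
Proof.
move=> uu' [[dx dy] [cx cy] cr].
have uu2 : \forall z' \near z, {near z', u =1 u'} by exact: near_join.
have D v : {near z, 'D_v u =1 'D_v u'}.
  by apply: filterS uu2 => z'; exact: near_eq_derive.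
have C v : {for z, continuous ('D_v u)} -> {for z, continuous ('D_v u')}.
  move=> cv; have -> : 'D_v u' = 'D_v u' by [].
  rewrite /prop_for /continuous_at -(nbhs_singleton (D v)).
  apply: cvg_trans cv; apply: near_eq_cvg.
  by apply: filterS (D v) => z'.
split; last by rewrite -!(nbhs_singleton (D _)).
  by split; [exact: near_eq_derivable dx|exact: near_eq_derivable dy].
split; [exact: (C _ cx)|exact: (C _ cy)].
Qed.

Lemma slice_regular_eq U F G : open U -> (forall p, U p -> F p = G p) ->
  slice_regular U F -> slice_regular U G.
Proof.
move=> Uo FG /slice_regularP FU; apply/slice_regularP => I z I2 Uz.
apply: regular_at_near_eq (FU I z I2 Uz).
by have := near_slice_pt Uo Uz; apply: filterS => z' /FG.
Qed.

Lemma slice_regularB U F G : open U -> slice_regular U F -> slice_regular U G ->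
  slice_regular U (fun p => F p - G p).
Proof.
move=> Uo /slice_regularP FU /slice_regularP GU; apply/slice_regularP => I z I2 Uz.
have [[Fx Fy] [cFx cFy] crF] := FU I z I2 Uz.
have [[Gx Gy] [cGx cGy] crG] := GU I z I2 Uz.
have -> : slice (fun p => F p - G p) I = slice F I - slice G I by [].
have near_reg : \forall z' \near z, regular_at I z' (slice F I) /\
    regular_at I z' (slice G I).
  by have := near_slice_pt Uo Uz; apply: filterS => z' Uz'; split;
    [exact: FU|exact: GU].
have C v : {near z, 'D_v (slice F I) - 'D_v (slice G I) =1
      'D_v (slice F I - slice G I)} ->
    {for z, continuous ('D_v (slice F I))} ->
    {for z, continuous ('D_v (slice G I))} ->
    {for z, continuous ('D_v (slice F I - slice G I))}.
  move=> FG cF cG; rewrite /prop_for /continuous_at -(nbhs_singleton FG).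
  have cFG : {for z, continuous ('D_v (slice F I) - 'D_v (slice G I))}.
    exact: cvgB cF cG.
  apply: cvg_trans cFG; apply: near_eq_cvg.
  by apply: filterS FG => z'.
split; last by rewrite !deriveB// mulrBr addrACA -opprD scalerBr crF crG subrr.
  by split; apply: derivableB.
split; apply: C => //; apply: filterS near_reg => z' [[[? ?] _ _] [[? ?] _ _]];
  by rewrite deriveB.
Qed.

Lemma slice_regular_cst U (k : quat R) : slice_regular U (fun=> k).
Proof.
apply/slice_regularP => I z I2 Uz.
have E : slice (fun=> k) I = cst k by [].
have D v : 'D_v (cst k : R * R -> quat R) = cst 0.
  by apply/funext => z'; exact: derive_cst.
rewrite E; split; rewrite ?D.
- by split; exact: derivable_cst.
- by split; exact: cst_continuous.
- by rewrite !derive_cst mulr0 addr0 scaler0.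
Qed.

Lemma slice_regular_translate U F (h : R) : slice_regular U F ->
  slice_regular [set p | U (p + h%:A)] (fun p => F (p + h%:A)).
Proof.
move=> /slice_regularP FU; apply/slice_regularP => I z I2 /= Uz.
have E : slice (fun p => F (p + h%:A)) I = (fun z' => slice F I (z' + (h, 0))).
  by apply/funext => z'; rewrite /slice -!/(slice_pt I _) slice_ptD.
rewrite -slice_ptD in Uz; have [[dx dy] [cx cy] cr] := FU I _ I2 Uz.
have D v : 'D_v (fun z' => slice F I (z' + (h, 0))) =
    (fun z' => 'D_v (slice F I) (z' + (h, 0))).
  by apply/funext => z'; have [_ ->] := derive_translate (slice F I) z' v (h, 0).
have sc : {for z, continuous (fun z' : R * R => z' + (h, 0))}.
  have c1 : (fun z' : R * R => z') @ z --> z by exact: cvg_id.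
  exact: (cvgD c1 (cvg_cst (h, 0))).
have Dz v : 'D_v (fun z' => slice F I (z' + (h, 0))) z =
    'D_v (slice F I) (z + (h, 0)) by exact: (congr1 (@^~ z) (D v)).
rewrite E; split; last by rewrite !Dz; exact: cr.
  have [Hx _] := derive_translate (slice F I) z (1, 0) (h, 0).
  have [Hy _] := derive_translate (slice F I) z (0, 1) (h, 0).
  by split; [exact: (iffRL Hx dx)|exact: (iffRL Hy dy)].
have cD v : {for z + (h, 0), continuous ('D_v (slice F I))} ->
    {for z, continuous ('D_v (fun z' => slice F I (z' + (h, 0))))}.
  move=> cv; rewrite D.
  exact: (@continuous_comp _ _ _ (fun z' : R * R => z' + (h, 0))
    ('D_v (slice F I)) z sc cv).
by split; [exact: (cD _ cx)|exact: (cD _ cy)].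
Qed.

End SliceRegularity.

(** * A Liouville theorem on quaternionic tori *)

Section TorusLiouville.
Variable R : realType.
Implicit Types (p q w I : quat R) (K : quat R -> quat R).

Lemma qdot_linear w : linear (fun q => qdot q w : R).
Proof. by move=> a p q; rewrite qdotDl qdotZl. Qed.

Lemma qdot_continuous w : continuous (fun q => qdot q w).
Proof.
have -> : (fun q => qdot q w) = (fun q => qre q * qre w + qi q * qi w +
    qj q * qj w + qk q * qk w) by apply/funext => q; rewrite qdotE.
have M (j : 'I_4) (a : R) : continuous (fun q : quat R => q ord0 j * a).
  move=> q; have cj := @coord_continuous R 1 4 ord0 j q.
  exact: (cvgM cj (cvg_cst a)).
move=> q; exact: (cvgD (cvgD (cvgD (M _ _ q) (M _ _ q)) (M _ _ q)) (M _ _ q)).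
Qed.

Lemma is_derive_qdot (u : R * R -> quat R) (x v : R * R) (du w : quat R) :
  is_derive x v u du -> is_derive x v (fun z => qdot (u z) w) (qdot du w).
Proof.
pose l : {linear quat R -> R} := HB.pack (fun q => qdot q w : R)
  (GRing.isLinear.Build _ _ _ _ _ (qdot_linear w)).
move=> ud; exact: (@is_derive_linear _ _ _ _ l u x v du (@qdot_continuous w) ud).
Qed.

(** Left multiplication by [I] is an isometry that takes the first partial
    derivative of a slice regular function to the second one. So the inner
    products with [w] and with [I w] satisfy the Cauchy-Riemann equations. *)
Lemma slice_max K I w (z0 : R * R) : slice_regular setT K -> I ^+ 2 = -1 ->
  (forall z, qdot (K (slice_pt I z)) w <= qdot (K (slice_pt I z0)) w) ->
  forall z, qdot (K (slice_pt I z)) w = qdot (K (slice_pt I z0)) w.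
Proof.
move=> /slice_regularP KU I2 Kmax.
have [I0 I1] := iffLR (imag_unitE I) I2.
pose u := slice K I.
have reg z : regular_at I z u by exact: KU.
have dx (z : R * R) : is_derive z (1, 0) u ('D_(1, 0) u z).
  by have [[d _] _ _] := reg z; exact: derivableP.
have dy (z : R * R) : is_derive z (0, 1) u (I * 'D_(1, 0) u z).
  have [[_ d] _ cr] := reg z.
  suff -> : I * 'D_(1, 0) u z = 'D_(0, 1) u z by exact: derivableP.
  move/eqP: cr; rewrite scaler_eq0 invr_eq0 pnatr_eq0/= addr_eq0 => /eqP->.
  by rewrite mulrN mulrA -expr2 I2 mulN1r opprK.
have cx : continuous ('D_(1, 0) u) by move=> z; have [_ [d _] _] := reg z.
have cI w' : continuous (fun z : R * R => qdot ('D_(1, 0) u z) w').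
  move=> z; apply: (@continuous_comp _ _ _ ('D_(1, 0) u) (fun q => qdot q w')).
    exact: cx.
  exact: qdot_continuous.
have IE q : qdot (I * q) w = - qdot q (I * w).
  by rewrite !qdotE !quatE I0; ring.
have IIE q : qdot (I * q) (I * w) = qdot q w.
  have := I1; rewrite qnormsqE !qdotE !quatE => N1.
  by rewrite -[RHS]mul1r -N1; ring.
apply: (@harmonic_max R (fun z => qdot (u z) w) (fun z => qdot (u z) (I * w))
  (fun z => qdot ('D_(1, 0) u z) w) (fun z => - qdot ('D_(1, 0) u z) (I * w))).
- by move=> z; exact: is_derive_qdot.
- by move=> z; rewrite -IE; exact: is_derive_qdot.
- by move=> z; rewrite opprK; exact: is_derive_qdot.
- by move=> z; rewrite -IIE; exact: is_derive_qdot.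
- exact: cI.
- by move=> z; apply: cvgN; exact: cI.
- exact: Kmax.
Qed.

Lemma quat_closed_ball_compact (B : R) : compact [set q : quat R | `|q| <= B].
Proof.
apply: (@bounded_closed_compact R 4).
  by exists B; split=> [|M BM q /= qB]; [exact: num_real|exact: ltW (le_lt_trans qB BM)].
apply: (@closed_comp _ _ (fun q : 'rV[R]_4 => `|q|) [set x | x <= B]).
  by move=> q _; exact: norm_continuous.
exact: closed_le.
Qed.

(** Every slice contains [0], so it does not matter in which slice the inner
    product of [K] with a vector attains its maximum: the maximum is the value
    at [0]. For the vector [K q - K 0] this gives [|K q - K 0|^2 <= 0]. *)
Lemma torus_liouville (L : lattice R) K : continuous K -> slice_regular setT K ->
  (forall p q, lat_set L (p - q) -> K p = K q) -> forall q, K q = K 0.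
Proof.
move=> cK rK perK q.
have [B BP] := lattice_cocompact L.
have maxK w : forall p, qdot (K p) w <= qdot (K 0) w.
  pose A := [set d : quat R | `|d| <= B].
  have A0 : A !=set0 by have [d dB _] := BP 0; exists d.
  have cg : {within A, continuous (fun p => qdot (K p) w)}.
    apply: continuous_subspaceT => p.
    exact: (@continuous_comp _ _ _ K (fun q => qdot q w) p (cK p)
      (@qdot_continuous w (K p))).
  have [q0 _ q0max] := compact_EVT_max A0 (@quat_closed_ball_compact B) cg.
  have gmax p : qdot (K p) w <= qdot (K q0) w.
    by have [d dB /perK ->] := BP p; apply: q0max; rewrite inE.
  have [I [x [y [I2 q0E]]]] := slice_decomposition q0.
  have z0 : 0 = slice_pt I (0, 0) by rewrite /slice_pt/= !scale0r addr0.
  move=> p; rewrite [in leRHS]z0 (@slice_max K I w (x, y))// => [|z].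
    by rewrite /slice_pt /= -q0E.
  by rewrite [in leRHS]/slice_pt /= -q0E.
apply/eqP; rewrite -subr_eq0 -qnormsq_eq0 eq_le qnormsq_ge0 andbT.
by rewrite /qnormsq qdotDl qdotNl subr_le0.
Qed.

End TorusLiouville.

(** * Regular maps between tori are affine *)

Section LineLemmas.
Variable R : realType.

Lemma is_derive_scalel (b : quat R) (x : R) :
  is_derive x 1 (fun t : R => t *: b) b.
Proof.
have d : differentiable (fun t : R => t *: b) x by [].
constructor; first exact/derivable1_diffP.
by rewrite deriveE// diff_val scale1r.
Qed.

(** The inner product of [u t - t b] with any fixed vector has derivative
    zero near [t0]. *)
Lemma locally_affine (u : R -> quat R) (b : quat R) (t0 : R) :
  (\forall t \near t0, is_derive (t : R) 1 u b) ->
  \forall t \near t0, u t - t *: b = u t0 - t0 *: b.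
Proof.
move=> /nbhs_ballP[r /= r0 rP]; apply/nbhs_ballP; exists r => //= t tr.
apply/eqP; rewrite -subr_eq0 -qnormsq_eq0; apply/eqP; set w := (X in qnormsq X).
have dphi (x : R) : `|x - t0| <= `|t - t0| ->
    is_derive x 1 (fun t => qdot (u t - t *: b) w) 0.
  move=> xt; have dx : is_derive x 1 u b.
    by apply: rP; rewrite /ball /= distrC; apply: le_lt_trans xt _; rewrite distrC.
  have db : is_derive x 1 (fun t : R => u t - t *: b) 0.
    by have := is_deriveB dx (is_derive_scalel b x); rewrite subrr.
  pose l : {linear quat R -> R} := HB.pack (fun q => qdot q w : R)
    (GRing.isLinear.Build _ _ _ _ _ (qdot_linear w)).
  have := @is_derive_linear _ _ _ _ l _ x 1 0 (@qdot_continuous R w) db.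
  by rewrite linear0.
have [c _] := MVT_unordered dphi.
by rewrite mul0r -qdotNl -qdotDl.
Qed.

(** The characteristic function of the condition is locally constant, so it
    has derivative zero and is constant. *)
Lemma locally_congruent_line (L : lattice R) (G : R -> quat R) :
  (forall t0, \forall t \near t0, lat_set L (G t - G t0)) ->
  forall t, lat_set L (G t - G 0).
Proof.
move=> loc t; pose chi t : R := (`[< lat_set L (G t - G 0) >])%:R.
have dchi (t0 : R) : is_derive t0 1 chi 0.
  apply: near_eq_is_derive (is_derive_cst (chi t0) t0 1).
  apply: filterS (loc t0) => t' Lt; rewrite /cst /chi.
  congr (_%:R); congr (nat_of_bool _); apply/asboolP/asboolP => H.
    by have := latD Lt H; rewrite subrKA.
  have := latB H Lt; congr (lat_set L _).
  by apply: quatP; rewrite !quatE; ring.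
have [c _] := @MVT_unordered R chi (fun=> 0) 0 t (fun t _ => dchi t).
rewrite mul0r => /eqP; rewrite subr_eq0 /chi subrr => /eqP.
have -> : `[< lat_set L 0 >] by apply/asboolP; exact: lat0.
by case: asboolP => // _ /eqP; rewrite eq_sym oner_eq0.
Qed.

End LineLemmas.

Section Steps.
Variable R : realType.
Variables (L L' : lattice R) (f : torus L -> torus L').
Hypothesis fr : regular_map f.
Implicit Types (p q k w I : quat R) (h e : R).
Local Notation s := (rep_lift f).
Variable c : R.
Hypothesis c_gt0 : 0 < c.
Hypothesis cP : forall l, lat_set L' l -> `|l| < c -> l = 0.

Lemma norm_ltD (x y : quat R) (a b : R) : `|x| < a -> `|y| < b -> `|x + y| < a + b.
Proof. by move=> xa yb; apply: le_lt_trans (ler_normD _ _) _; exact: ltrD. Qed.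
Lemma norm_ltB (x y : quat R) (a b : R) : `|x| < a -> `|y| < b -> `|x - y| < a + b.
Proof. by move=> xa yb; apply: norm_ltD => //; rewrite normrN. Qed.

(** Uniform continuity of [f] composed with the projection, from compactness
    of a ball that meets every class modulo [L]. *)
Lemma small_steps e : 0 < e -> \forall h \near (0 : R),
  forall q, exists2 k, `|k| < e & lat_set L' (s (q + h%:A) - s q - k).
Proof.
move=> e0; have [B BP] := lattice_cocompact L.
pose P h (d : quat R) := exists2 k, `|k| < e & lat_set L' (s (d + h%:A) - s d - k).
have e2 : 0 < e / 2 by rewrite divr_gt0.
have cov := iffLR (compact_near_coveringP _) (@quat_closed_ball_compact R B).
have Pnear : forall d : quat R, `|d| <= B -> \forall d' \near d & h \near (0 : R), P h d'.
  move=> d _.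
  pose A p := exists2 k, `|k| < e / 2 & lat_set L' (s p - s d - k).
  have nA : \forall p \near d, A p by exact: (rep_lift_continuous fr c_gt0 cP d e2).
  have sc : {for (d, 0 : R), continuous (fun z : quat R * R => z.1 + z.2%:A)}.
    have c0 : {for (0 : R), continuous (fun x : R => x%:A : quat R)}.
      exact: scalel_continuous.
    have c1 : (fun z : quat R * R => z.2) @ (d, 0 : R) --> (0 : R) by exact: cvg_snd.
    have c2 : (fun z : quat R * R => z.2%:A : quat R) @ (d, 0 : R) -->
        ((0 : R)%:A : quat R) by exact: (continuous_cvg _ c0 c1).
    exact: (cvgD cvg_fst c2).
  have nA2 : \forall z \near (d, 0 : R), A (z.1 + z.2%:A).
    by apply: (@near_fun _ _ _ (d, 0 : R) A sc); rewrite /= scale0r addr0.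
  have nA1 : \forall z \near (d, 0 : R), A z.1.
    by apply: (@near_fun _ _ fst (d, 0 : R) A); [exact: cvg_fst|].
  apply: filterS2 nA1 nA2 => -[p h] [/= k1 k1e L1] [/= k2 k2e L2].
  exists (k2 - k1); first by rewrite [e]splitr; exact: norm_ltB.
  have := latB L2 L1; congr (lat_set L' _).
  by apply: quatP; rewrite !quatE; ring.
apply: filterS (cov R (nbhs (0 : R)) P _ Pnear) => h Ph q.
have [d dB Lqd] := BP q; have [k ke Lk] := Ph d dB; exists k => //.
rewrite (rep_lift_periodic f Lqd).
by rewrite (@rep_lift_periodic _ _ _ f (q + h%:A) (d + h%:A)) // opprD addrACA subrr addr0.
Qed.

Fact step_cocycle (a2 a1 b2 b1 s2 s1 t2 t1 k l : quat R) :
  (a2 - s2 - (b2 - t2)) - (a1 - s1 - (b1 - t1)) +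
    ((s2 - s1 - k) - (t2 - t1 - l)) = a2 - a1 - (b2 - b1 - l) - k.
Proof. by apply: quatP; rewrite !(@quatDE R, quatNE); ring. Qed.

Fact step_estimate (a2 a1 b2 b1 s2 s1 k l : quat R) :
  (a2 - s2 - (b2 - s2)) - (a1 - s1 - (b1 - s1)) - (k - l) =
    a2 - a1 - (b2 - b1 - l) - k.
Proof. by apply: quatP; rewrite !(@quatDE R, quatNE); ring. Qed.

Variable e : R.
Hypothesis e_gt0 : 0 < e.
Hypothesis ec : e + e + (e + e) + (e + e) <= c.

(** The values stay within [e] of a fixed point, so that congruent values of
    two such functions can be compared through the discreteness of [L']. *)
Definition is_lift (U : set (quat R)) (F : quat R -> quat R) q0 : Prop :=
  [/\ open U, U q0, slice_regular U F &
      forall p, U p -> `|F p - s q0| < e /\ lat_set L' (F p - s p)].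

Lemma is_lift_ex q0 : exists U F, is_lift U F q0.
Proof. by apply: (local_lift fr cP) => //; have := ec; have := e_gt0; lra. Qed.

(** The increment of [s] by the step [h], taken modulo [L'] in the ball of
    radius [e], is [F2 (p + h) - F1 p] up to a constant when [F1] and [F2] are
    lifts near [q] and near [q + h]. Hence it is slice regular, and
    [torus_liouville] applies. The comparison involves six quantities of norm
    less than [e], which is the reason for the bound on [e]. *)
Lemma step_const h :
  (forall q, exists2 k, `|k| < e & lat_set L' (s (q + h%:A) - s q - k)) ->
  exists2 k, `|k| < e & forall q, lat_set L' (s (q + h%:A) - s q - k).
Proof.
move=> hP.
pose K q := xget 0 [set k | `|k| < e /\ lat_set L' (s (q + h%:A) - s q - k)].
have KP q : `|K q| < e /\ lat_set L' (s (q + h%:A) - s q - K q).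
  apply: (@xgetPex _ 0 [set k | `|k| < e /\ lat_set L' (s (q + h%:A) - s q - k)]).
  by have [k k1 k2] := hP q; exists k.
have Kper p q : lat_set L (p - q) -> K p = K q.
  move=> Lpq; rewrite /K (rep_lift_periodic f Lpq).
  by rewrite (@rep_lift_periodic _ _ _ f (p + h%:A) (q + h%:A)) // opprD addrACA subrr addr0.
have loc q : exists U G, [/\ open U, U q, slice_regular U G,
    {for q, continuous G} & forall p, U p -> G p = K p].
  have [U1 [F1 [op1 U1q r1 P1]]] := is_lift_ex q.
  have [U2 [F2 [op2 U2q r2 P2]]] := is_lift_ex (q + h%:A).
  have c1 : {for q, continuous F1}.
    by apply: (lift_continuous fr c_gt0 cP op1 U1q _ P1); have := ec; have := e_gt0; lra.
  have c2 : {for q + h%:A, continuous F2}.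
    by apply: (lift_continuous fr c_gt0 cP op2 U2q _ P2); have := ec; have := e_gt0; lra.
  pose l0 := F2 (q + h%:A) - F1 q - K q.
  have sc : continuous (fun p : quat R => p + h%:A).
    move=> p; have cid : (fun p : quat R => p) @ p --> p by exact: cvg_id.
    exact: (cvgD cid (cvg_cst (h%:A : quat R))).
  pose U := U1 `&` [set p | U2 (p + h%:A)].
  have oU : open U.
    by apply: openI => //; apply: open_comp => // p _; exact: sc.
  exists U, (fun p => F2 (p + h%:A) - F1 p - l0).
  split; [exact: oU|by split| | |].
  - apply: (slice_regularB oU); last exact: slice_regular_cst.
    apply: (slice_regularB oU).
    + move=> I I2 z [_ Uz].
      exact: (slice_regular_translate r2 I2 Uz).
    + by move=> I I2 z [Uz _]; exact: r1.
  - have c2' : (fun p => F2 (p + h%:A)) @ q --> F2 (q + h%:A).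
      exact: (@continuous_comp _ _ _ (fun p : quat R => p + h%:A) F2 q (sc q) c2).
    exact: (cvgB (cvgB c2' c1) (cvg_cst l0)).
  - move=> p [Up1 Up2].
    have [a1 b1] := P1 _ Up1; have [a2 b2] := P2 _ Up2.
    have [a3 b3] := P1 _ U1q; have [a4 b4] := P2 _ U2q.
    have [a5 b5] := KP p; have [a6 b6] := KP q.
    apply/eqP; rewrite -subr_eq0; apply/eqP/cP.
      rewrite -(step_cocycle _ _ _ _ (s (p + h%:A)) (s p) (s (q + h%:A)) (s q)).
      exact: latD (latB (latB b2 b4) (latB b1 b3)) (latB b5 b6).
    apply: lt_le_trans ec; rewrite -(step_estimate _ _ _ _ (s (q + h%:A)) (s q)).
    exact: norm_ltB (norm_ltB (norm_ltB a2 a4) (norm_ltB a1 a3)) (norm_ltB a5 a6).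
have Kreg : slice_regular setT K.
  move=> I I2 z _; have [U [G [oU Uq rG _ GK]]] := loc (slice_pt I z).
  exact: (slice_regular_eq oU GK rG I2 Uq).
have Kcont : continuous K.
  move=> q; have [U [G [oU Uq _ cG GK]]] := loc q.
  have nU : nbhs q U by exact: open_nbhs_nbhs.
  have GKn : {near q, G =1 K} by apply: filterS nU => p /GK.
  have cGK : G @ q --> K q by rewrite -(GK _ Uq).
  exact: cvg_trans (near_eq_cvg GKn) cGK.
have Kcst := torus_liouville Kcont Kreg Kper.
exists (K 0); first by have [] := KP 0.
by move=> q; rewrite -(Kcst q); have [] := KP q.
Qed.

End Steps.

Section AffineLift.
Variable R : realType.
Variables (L L' : lattice R) (f : torus L -> torus L').
Hypothesis fr : regular_map f.
Implicit Types (p q k w I : quat R) (h : R).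
Local Notation s := (rep_lift f).
Variable c : R.
Hypothesis c_gt0 : 0 < c.
Hypothesis cP : forall l, lat_set L' l -> `|l| < c -> l = 0.
Variable e : R.
Hypothesis e_gt0 : 0 < e.
Hypothesis ec : e + e + (e + e) + (e + e) <= c.
Local Notation is_lift := (is_lift f e).

Definition step h : quat R :=
  xget 0 [set k | `|k| < e /\ forall q, lat_set L' (s (q + h%:A) - s q - k)].

Lemma near_step : \forall h \near (0 : R),
  `|step h| < e /\ forall q, lat_set L' (s (q + h%:A) - s q - step h).
Proof.
have := small_steps fr c_gt0 cP e_gt0; apply: filterS => h hP.
have [k ke kL] := step_const fr c_gt0 cP e_gt0 ec hP.
apply: (@xgetPex _ 0 [set k | `|k| < e /\ forall q, lat_set L' (s (q + h%:A) - s q - k)]).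
by exists k.
Qed.

(** The limit exists and is the derivative of every lift in the real
    direction, by [lift_derivative]. *)
Definition slope : quat R := lim (h^-1 *: step h @[h --> (0 : R)^']).

Fact lift_step_cocycle (a b u v k : quat R) :
  (a - u) - (b - v) + (u - v - k) = a - b - k.
Proof. by apply: quatP; rewrite !(@quatDE R, quatNE); ring. Qed.

Fact lift_step_estimate (a b u k : quat R) :
  (a - u) - (b - u) - k = a - b - k.
Proof. by apply: quatP; rewrite !(@quatDE R, quatNE); ring. Qed.

(** The increment of a lift by a small real step [h] is [step h] wherever it
    is taken. The derivative along the imaginary direction follows from the
    Cauchy-Riemann equation. *)
Lemma lift_derivative U F q0 I z : is_lift U F q0 -> I ^+ 2 = -1 ->
  U (slice_pt I z) ->
  is_derive z (1, 0) (slice F I) slope /\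
  is_derive z (0, 1) (slice F I) (I * slope).
Proof.
move=> [oU Uq0 rF FP] I2 Uz.
have [[dx dy] _ cr] := iffLR (slice_regularP _ _) rF I z I2 Uz.
have sc : {for 0, continuous (fun h : R => slice_pt I z + h%:A)}.
  have c1 : (fun h : R => h%:A : quat R) @ (0 : R) --> ((0 : R)%:A : quat R).
    exact: scalel_continuous.
  exact: (cvgD (cvg_cst (slice_pt I z)) c1).
have nU : \forall h \near (0 : R), U (slice_pt I z + h%:A).
  apply: (@near_fun _ _ _ (0 : R) U sc).
  by apply: open_nbhs_nbhs; split=> //; rewrite scale0r addr0.
have stepE : \forall h \near (0 : R),
    slice F I (z + (h, 0)) - slice F I z = step h.
  near=> h.
  have Uh : U (slice_pt I z + h%:A) by near: h.
  have [se sL] : `|step h| < e /\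
      forall q, lat_set L' (s (q + h%:A) - s q - step h).
    by near: h; exact: near_step.
  have [a1 b1] := FP _ Uz; have [a2 b2] := FP _ Uh.
  rewrite -[slice F I _]/(F (slice_pt I _)) slice_ptD -[slice F I _]/(F (slice_pt I _)).
  apply/eqP; rewrite -subr_eq0; apply/eqP/cP.
    rewrite -(lift_step_cocycle _ _ (s (slice_pt I z + h%:A)) (s (slice_pt I z))).
    by apply: latD (latB b2 b1) _; exact: sL.
  rewrite -(lift_step_estimate _ _ (s q0)).
  apply: lt_le_trans (norm_ltB (norm_ltB a2 a1) se) _.
  by have := ec; have := e_gt0; lra.
have slopeE : 'D_(1, 0) (slice F I) z = slope.
  apply/esym/cvg_lim; first exact: norm_hausdorff.
  apply: cvg_trans dx; apply: near_eq_cvg.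
  apply: cvg_within; apply: filterS stepE => h <- /=.
  have -> : h *: ((1, 0) : R * R) = (h, 0).
    by congr pair; [exact: mulr1|exact: mulr0].
  by rewrite [(h, 0) + z]addrC.
split; first by rewrite -slopeE; exact: derivableP.
suff -> : I * slope = 'D_(0, 1) (slice F I) z by exact: derivableP.
move/eqP: cr; rewrite slopeE scaler_eq0 invr_eq0 pnatr_eq0/= addr_eq0 => /eqP->.
by rewrite mulrN mulrA -expr2 I2 mulN1r opprK.
Unshelve. all: by end_near.
Qed.

(** If every lift has constant derivative [b] along the parametrized line [l],
    then a lift minus its linear part is locally constant along [l]. Modulo [L']
    this does not depend on the lift, so it holds along the whole line. *)
Lemma lift_line (l : R -> quat R) (b : quat R) : continuous l ->
  (forall U F q0 (t : R), is_lift U F q0 -> U (l t) ->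
    is_derive t 1 (fun t => F (l t)) b) ->
  forall t, lat_set L' (s (l t) - t *: b - s (l 0)).
Proof.
move=> lc dl t; pose G t := s (l t) - t *: b.
suff : lat_set L' (G t - G 0) by rewrite /G scale0r subr0.
apply: locally_congruent_line => {t} t0.
have [U [F UF]] := is_lift_ex fr cP e_gt0 ec (l t0).
have [oU Uq _ FP] := UF.
have nU : \forall t \near t0, U (l t).
  by apply: (@near_fun _ _ l t0 U); [exact: lc|exact: open_nbhs_nbhs].
have dF : \forall t \near t0, is_derive (t : R) 1 (fun t => F (l t)) b.
  by apply: filterS nU => t Ut; exact: dl UF Ut.
have A := locally_affine dF.
near=> t.
have Ut : U (l t) by near: t.
have Et : F (l t) - t *: b = F (l t0) - t0 *: b by near: t.
have [_ b1] := FP _ Ut; have [_ b2] := FP _ Uq.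
have := latB b2 b1; congr (lat_set L' _); rewrite /G.
move: Et => /eqP; rewrite subr_eq => /eqP ->.
move: (F _) (s _) (s _) (t *: _) (t0 *: _) => A1 A2 A3 A4 A5.
by apply: quatP; rewrite !(@quatDE R, quatNE); ring.
Unshelve. all: by end_near.
Qed.

Lemma lift_horizontal I x : I ^+ 2 = -1 ->
  lat_set L' (s (slice_pt I (x, 0)) - x *: slope - s (slice_pt I (0, 0))).
Proof.
move=> I2; apply: (lift_line (l := fun t : R => slice_pt I (t, 0))).
  move=> t; have c1 : (fun t : R => t) @ t --> t by exact: cvg_id.
  exact: (continuous_cvg _ (@slice_pt_continuous R I (t, 0))
    (cvg_pair c1 (cvg_cst (0 : R)))).
move=> U F q0 t UF Ut; apply: (iffLR (is_derive_hline (slice F I) t 0 _)).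
by have [] := @lift_derivative U F _ I (t, 0) UF I2 Ut.
Qed.

Lemma lift_vertical I x y : I ^+ 2 = -1 ->
  lat_set L' (s (slice_pt I (x, y)) - y *: (I * slope) - s (slice_pt I (x, 0))).
Proof.
move=> I2; apply: (lift_line (l := fun t : R => slice_pt I (x, t))).
  move=> t; have c1 : (fun t : R => t) @ t --> t by exact: cvg_id.
  exact: (continuous_cvg _ (@slice_pt_continuous R I (x, t))
    (cvg_pair (cvg_cst x) c1)).
move=> U F q0 t UF Ut; apply: (iffLR (is_derive_vline (slice F I) x t _)).
by have [] := @lift_derivative U F _ I (x, t) UF I2 Ut.
Qed.

(** A point [x + y I] is reached from [0] along the real axis and then along
    the parallel to [I]. *)
Lemma lift_affine q : lat_set L' (s q - (q * slope + s 0)).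
Proof.
have [I [x [y [I2 ->]]]] := slice_decomposition q.
have := latD (lift_vertical x y I2) (lift_horizontal x I2).
congr (lat_set L' _).
have -> : slice_pt I (0, 0) = 0 by rewrite /slice_pt /= !scale0r addr0.
rewrite mulrDl -!scalerAl mul1r -[x%:A + y *: I]/(slice_pt I (x, y)).
move: (s (slice_pt I (x, y))) (s (slice_pt _ _)) (s 0) (x *: slope).
move: (y *: (I * slope)) => A1 A2 A3 A4 A5.
by apply: quatP; rewrite !(@quatDE R, quatNE); ring.
Qed.

End AffineLift.

Section Rigidity.
Variable R : realType.
Implicit Types L : lattice R.

Theorem regular_map_affine L L' (f : torus L -> torus L') : regular_map f ->
  exists a b, forall q, f (torus_proj L q) = torus_proj L' (q * a + b).
Proof.
move=> fr; have [c c0 cP] := lattice_discrete L'.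
pose e := c / 6.
have e0 : 0 < e by rewrite divr_gt0.
have ec : e + e + (e + e) + (e + e) <= c by rewrite /e; lra.
exists (slope f e), (rep_lift f 0) => q.
rewrite -proj_rep_lift; apply/torus_proj_eq.
exact: (lift_affine fr c0 cP e0 ec).
Qed.

(** Otherwise small real multiples of [q] would be short lattice vectors. *)
Lemma lattice_real_line L (b q : quat R) :
  (forall t : R, lat_set L (t *: q + b)) -> q = 0.
Proof.
move=> Lq; have [c c0 cP] := lattice_discrete L.
pose t := c / (1 + `|q|).
have t0 : 0 < t by rewrite divr_gt0 // ltr_pwDl.
have /eqP : t *: q = 0.
  apply: cP; first by have := latB (Lq t) (Lq 0); rewrite scale0r add0r addrK.
  rewrite normrZ gtr0_norm// /t mulrAC ltr_pdivrMr ?ltr_pwDl//.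
  by rewrite ltr_pM2l// ltrDr.
by rewrite scaler_eq0 (gt_eqF t0) => /eqP.
Qed.

(** The composites of the two affine maps induce the identity on the tori, so
    their linear parts are inverse to each other. *)
Theorem equivalent_tori_similar L L' : equivalent_tori L L' ->
  exists a a', [/\ a * a' = 1, a' * a = 1 &
    forall q, lat_set L q <-> lat_set L' (q * a)].
Proof.
move=> [f [g [fK gK fr gr]]].
have [a [b fE]] := regular_map_affine fr.
have [a' [b' gE]] := regular_map_affine gr.
have H1 (q : quat R) : lat_set L (q - ((q * a + b) * a' + b')).
  by apply/torus_proj_eq; rewrite -gE -fE fK.
have H2 (q : quat R) : lat_set L' (q - ((q * a' + b') * a + b)).
  by apply/torus_proj_eq; rewrite -fE -gE gK.
have inv (M : lattice R) (u v x y : quat R) :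
    (forall q, lat_set M (q - ((q * u + x) * v + y))) -> u * v = 1.
  move=> H; apply/eqP; rewrite -subr_eq0 -oppr_eq0 opprB; apply/eqP.
  apply: (@lattice_real_line M (- (x * v + y))) => t.
  have := H t%:A; congr (lat_set M _).
  by rewrite -scalerAl mul1r mulrDl -scalerAl scalerBr -!addrA -opprD.
have aa' := inv _ _ _ _ _ H1; have a'a := inv _ _ _ _ _ H2.
exists a, a'; split=> // q.
have La p : lat_set L p -> lat_set L' (p * a).
  move=> Lp; have : torus_proj L p = torus_proj L 0.
    by apply/torus_proj_eq; rewrite subr0.
  move=> /(congr1 f); rewrite !fE => /torus_proj_eq.
  by rewrite mul0r add0r addrK.
have La' p : lat_set L' p -> lat_set L (p * a').
  move=> Lp; have : torus_proj L' p = torus_proj L' 0.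
    by apply/torus_proj_eq; rewrite subr0.
  move=> /(congr1 g); rewrite !gE => /torus_proj_eq.
  by rewrite mul0r add0r addrK.
split; first exact: La.
by move=> /La'; rewrite -mulrA aa' mulr1.
Qed.

End Rigidity.

(** * Similar lattices define equivalent tori *)

Section Similarities.
Variable R : realType.
Implicit Types (p q a : quat R) (L : lattice R).

Lemma qmulr_continuous a : continuous (fun q : quat R => q * a).
Proof.
move=> q; apply/(@cvgrPdist_lt _ _ _ (nbhs q)) => e e0.
have d0 : 0 < e / (4 * (1 + `|a|)) by rewrite divr_gt0 // mulr_gt0 // ltr_pwDl.
have nq : \forall p \near q, `|q - p| < e / (4 * (1 + `|a|)).
  have cid : (fun p : quat R => p) @ q --> q by exact: cvg_id.
  exact: (iffLR (@cvgrPdist_lt _ _ _ (nbhs q) _ _ _) cid).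
apply: filterS nq => p; rewrite ltr_pdivlMr ?mulr_gt0 ?ltr_pwDl// => pq.
rewrite -mulrBl; apply: le_lt_trans (norm_qmul _ _) _; apply: le_lt_trans pq.
by rewrite mulrCA ler_wpM2l// ler_pM2l// lerDr.
Qed.

Lemma slice_regular_mulr U a : slice_regular U (fun q => q * a).
Proof.
apply/slice_regularP => I z I2 _.
set u := slice _ I.
have dx (z' : R * R) : is_derive z' (1, 0) u a.
  case: z' => x y; apply/is_derive_hline.
  rewrite (_ : (fun t => _) = (fun t : R => t *: a) + cst (y *: (I * a))); last first.
    by apply/funext => t; rewrite /u /slice /= mulrDl -!scalerAl mul1r.
  by rewrite -[X in is_derive _ _ _ X]addr0; apply: is_deriveD; exact: is_derive_scalel.
have dy (z' : R * R) : is_derive z' (0, 1) u (I * a).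
  case: z' => x y; apply/is_derive_vline.
  rewrite (_ : (fun t => _) = cst (x *: a) + (fun t : R => t *: (I * a))); last first.
    by apply/funext => t; rewrite /u /slice /= mulrDl -!scalerAl mul1r.
  by rewrite -[X in is_derive _ _ _ X]add0r; apply: is_deriveD; exact: is_derive_scalel.
have Dx : 'D_(1, 0) u = cst a by apply/funext => z'; have [] := dx z'.
have Dy : 'D_(0, 1) u = cst (I * a) by apply/funext => z'; have [] := dy z'.
split.
- by split; [have [] := dx z|have [] := dy z].
- have cc (b : quat R) : {for z, continuous (cst b : R * R -> quat R)}.
    exact: cst_continuous.
  by split; [rewrite Dx; exact: cc|rewrite Dy; exact: cc].
- have [_ ->] := dx z; have [_ ->] := dy z.
  by rewrite mulrA -expr2 I2 mulN1r subrr scaler0.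
Qed.

Definition mulr_torus L L' a (x : torus L) : torus L' :=
  torus_proj L' (repr x * a).

Lemma mulr_torus_proj L L' a q : (forall p, lat_set L p -> lat_set L' (p * a)) ->
  mulr_torus L' a (torus_proj L q) = torus_proj L' (q * a).
Proof.
move=> La; apply/torus_proj_eq; rewrite -mulrBl; apply: La.
by apply/torus_proj_eq; exact: reprK.
Qed.

(** In charts the map is [q |-> q a - l], with [l] in [L'] locally constant. *)
Lemma mulr_torus_regular L L' a : (forall p, lat_set L p -> lat_set L' (p * a)) ->
  regular_map (mulr_torus L' a : torus L -> torus L').
Proof.
move=> La; split.
  apply/quotient_continuous.
  rewrite (_ : _ \o _ = torus_proj L' \o (fun q : quat R => q * a)); last first.
    by apply/funext => q /=; exact: mulr_torus_proj.
  move=> q; apply: continuous_comp; first exact: qmulr_continuous.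
  exact: proj_continuous.
move=> V V' _ VV' I I2 z [_ [v Vv vE]].
set p0 := z.1%:A + z.2 *: I in vE.
have Ll : lat_set L' (p0 * a - v).
  by apply/torus_proj_eq; rewrite vE /= mulr_torus_proj.
set l := p0 * a - v in Ll.
have [oV' _ _] := VV'.
pose W := [set q | V' (q * a - l)].
have oW : open W.
  apply: (@open_comp _ _ (fun q : quat R => q * a - l)) => // q _.
  exact: (cvgB (@qmulr_continuous a q) (cvg_cst (l : quat R))).
have Wp0 : W p0 by rewrite /W /= /l subKr.
have rW : slice_regular W (fun q => q * a - l).
  by apply: slice_regularB => //; [exact: slice_regular_mulr|exact: slice_regular_cst].
apply: (slice_regular_eq oW _ rW I2 Wp0) => q Wq.
rewrite -[LHS](chart_proj VV' Wq) /=; congr chart.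
rewrite mulr_torus_proj//; apply/torus_proj_eq.
by rewrite addrAC subrr add0r; exact: latN.
Qed.

Theorem similar_equivalent_tori L L' a a' : a * a' = 1 -> a' * a = 1 ->
  (forall q, lat_set L q <-> lat_set L' (q * a)) -> equivalent_tori L L'.
Proof.
move=> aa' a'a LL'.
have La p : lat_set L p -> lat_set L' (p * a) by move/LL'.
have La' p : lat_set L' p -> lat_set L (p * a').
  by move=> Lp; apply/LL'; rewrite -mulrA a'a mulr1.
exists (mulr_torus L' a), (mulr_torus L a'); split.
- move=> x; rewrite -[x]reprK -!/(torus_proj L (repr x)) !mulr_torus_proj//.
  by rewrite -mulrA aa' mulr1.
- move=> x; rewrite -[x]reprK -!/(torus_proj L' (repr x)) !mulr_torus_proj//.
  by rewrite -mulrA a'a mulr1.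
- exact: mulr_torus_regular.
- exact: mulr_torus_regular.
Qed.

End Similarities.

(** * Orthogonal projection onto a slice *)

Section SliceProjection.
Variable R : realType.
Variable I : quat R.
Hypothesis I2 : I ^+ 2 = -1.
Implicit Types (p q w g : quat R).

Let reI : qre I = 0. Proof. by have [] := iffLR (imag_unitE I) I2. Qed.
Let NI : qnormsq I = 1. Proof. by have [] := iffLR (imag_unitE I) I2. Qed.
Let II : I * I = -1. Proof. by rewrite -expr2. Qed.

(** Up to the factor [2], the orthogonal projections onto [R + R I] and onto
    its orthogonal complement. *)
Definition par q : quat R := q - I * q * I.
Definition perp q : quat R := q + I * q * I.

Lemma perpD p q : perp (p + q) = perp p + perp q.
Proof. by rewrite /perp mulrDr mulrDl addrACA. Qed.
Lemma perpN q : perp (- q) = - perp q.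
Proof. by rewrite /perp mulrN mulNr opprD. Qed.
Lemma perpB p q : perp (p - q) = perp p - perp q.
Proof. by rewrite perpD perpN. Qed.
Lemma parB p q : par (p - q) = par p - par q.
Proof. by rewrite /par mulrBr mulrBl !opprD !opprK addrACA. Qed.

Lemma perp_comm w : w * I = I * w -> perp w = 0.
Proof. by move=> wI; rewrite /perp -wI -mulrA II mulrN1 subrr. Qed.

Lemma par_comm w : w * I = I * w -> par w = 2 *: w.
Proof. by move=> wI; rewrite /par -wI -mulrA II mulrN1 opprK scaler_nat mulr2n. Qed.

Lemma perp_mulr q w : w * I = I * w -> perp (q * w) = perp q * w.
Proof. by move=> wI; rewrite /perp mulrDl -!mulrA wI. Qed.

Lemma perp_anticomm q : perp q * I = - (I * perp q).
Proof.
rewrite /perp mulrDl mulrDr -!mulrA II mulrN1 (mulrA I I) II mulN1r.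
by rewrite mulrN opprB.
Qed.

Lemma qnormsq_par_perp q : qnormsq (par q) + qnormsq (perp q) = 4 * qnormsq q.
Proof.
have E : qnormsq (I * q * I) = qnormsq q by rewrite !qnormsqM NI mul1r mulr1.
have P (t : quat R) :
    qnormsq (q - t) + qnormsq (q + t) = 2 * qnormsq q + 2 * qnormsq t.
  by rewrite !qnormsqE !quatE; ring.
by rewrite /par /perp P E; ring.
Qed.

Lemma par_slice q : par q = (2 * qre q)%:A + (2 * qdot q I) *: I.
Proof.
have -> : par q = qnormsq I *: q - I * q * I by rewrite NI scale1r.
have -> : (2 * qre q)%:A = (2 * qre q * qnormsq I)%:A :> quat R by rewrite NI mulr1.
by apply: quatP; rewrite qnormsqE qdotE !quatE reI; ring.
Qed.

Lemma perp_eq0_slice q : perp q = 0 -> q = (qre q)%:A + qdot q I *: I.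
Proof.
move=> q0; have : par q = 2 *: q.
  move/eqP: q0; rewrite /perp addrC addr_eq0 => /eqP E.
  by rewrite /par E opprK scaler_nat mulr2n.
move=> E; have two : 2 != 0 :> R by rewrite pnatr_eq0.
have -> : q = 2^-1 *: par q by rewrite E scalerA mulVf// scale1r.
rewrite {1}par_slice scalerDr !scalerA !mulrA mulVf// !mul1r.
by rewrite E scalerA mulVf// scale1r.
Qed.

(** Two quaternions that anticommute with [I] have a quotient that commutes
    with [I]. *)
Lemma perp_quotient p q : perp p != 0 -> exists2 w, w * I = I * w &
  perp q = perp p * w.
Proof.
move=> p0; exists (qinv (perp p) * perp q); last first.
  by rewrite mulrA qmulV// mul1r.
have H : qinv (perp p) * I = - (I * qinv (perp p)).
  set g := perp p in p0 *.
  have := congr1 (fun x => qinv g * x * qinv g) (perp_anticomm p).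
  rewrite -/g mulrN mulNr !mulrA qmulVl// mul1r -mulrA qmulV// mulr1 => ->.
  by rewrite opprK.
by rewrite -mulrA perp_anticomm mulrN !mulrA H mulNr opprK.
Qed.

End SliceProjection.

(** * Special bases of lattices with a symmetry *)

Section ReducedBasis.
Variable R : realType.
Variables (M : lattice R) (I e : quat R) (c s : R).
Hypothesis I2 : I ^+ 2 = -1.
Hypothesis eE : e = c%:A + s *: I.
Hypothesis s_neq0 : s != 0.
Hypothesis Ne : qnormsq e = 1.
Hypothesis c01 : 0 <= c <= 2^-1.
Hypothesis M1 : lat_set M 1.
Hypothesis Me : forall q, lat_set M q -> lat_set M (q * e).
Hypothesis Mmin : forall q, lat_set M q -> q != 0 -> 1 <= qnormsq q.
Implicit Types (p q w al : quat R) (x y z t : R).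

Let reI : qre I = 0. Proof. by have [] := iffLR (imag_unitE I) I2. Qed.
Local Notation perp := (perp I).
Local Notation par := (par I).
Local Notation cmb x y := (x%:A + y *: e).

Lemma re_e : qre e = c.
Proof. by rewrite eE !quatE reI; ring. Qed.

Lemma cmb_comm x y : cmb x y * I = I * cmb x y.
Proof.
have eI : e * I = I * e.
  by rewrite eE mulrDl mulrDr -!scalerAl -!scalerAr mul1r mulr1.
by rewrite mulrDl mulrDr -!scalerAl -!scalerAr mul1r mulr1 eI.
Qed.

Lemma perp_cmb x y : perp (cmb x y) = 0.
Proof. by apply: perp_comm => //; exact: cmb_comm. Qed.

Lemma perp_eq0_cmb q : perp q = 0 -> exists x y, q = cmb x y.
Proof.
move=> /(perp_eq0_slice I2) ->; move: (qre q) (qdot q I) => x y.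
exists (x - y * c / s), (y / s); rewrite eE scalerDr !scalerA divfK//.
rewrite addrA -scalerDl; congr (_ *: _ + _).
by rewrite mulrAC subrK.
Qed.

Lemma qnormsq_cmb x y : qnormsq (cmb x y) = x ^+ 2 + 2 * c * x * y + y ^+ 2.
Proof.
have -> : qnormsq (cmb x y) =
    x ^+ 2 + 2 * qre e * x * y + y ^+ 2 * qnormsq e.
  by rewrite !qnormsqE !quatE; ring.
by rewrite re_e Ne mulr1.
Qed.

Lemma cmb_eq0 x y : cmb x y = 0 -> x = 0 /\ y = 0.
Proof.
rewrite eE scalerDr !scalerA addrA -scalerDl => h.
have NI : qnormsq I = 1 by have [] := iffLR (imag_unitE I) I2.
have : qnormsq ((x + y * c)%:A + (y * s) *: I) =
    (x + y * c) ^+ 2 + (y * s) ^+ 2 * qnormsq I.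
  by rewrite !qnormsqE !quatE reI; ring.
rewrite NI mulr1.
rewrite h qnormsqE !quatE expr0n /= !addr0 => /esym/eqP.
rewrite paddr_eq0 ?sqr_ge0// !sqrf_eq0 mulf_eq0 (negPf s_neq0) orbF.
by move=> /andP[+ /eqP y0]; rewrite y0 mul0r addr0 => /eqP.
Qed.

Lemma lat_cmb (m k : int) : lat_set M (cmb m%:~R k%:~R).
Proof.
rewrite !scaler_int; apply: latD; apply: lat_mulz => //.
by rewrite -[e]mul1r; exact: Me.
Qed.

Lemma lat_mulr_cmb q (m k : int) : lat_set M q -> lat_set M (q * cmb m%:~R k%:~R).
Proof.
move=> Mq; rewrite mulrDr -!scalerAr mulr1 !scaler_int.
by apply: latD; apply: lat_mulz => //; exact: Me.
Qed.

Lemma round_half x : exists k : int, `|x - k%:~R| <= 2^-1.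
Proof.
exists (Num.floor (x + 2^-1)); have /andP[] := floor_itv (x + 2^-1).
by rewrite intrD ler_norml => h1 h2; apply/andP; split; lra.
Qed.

(** Since [|x + y e|^2 = (x + c y)^2 + (1 - c^2) y^2], it suffices to round
    [y] and then to round [x] shifted so that [x + c y] becomes small. *)
Lemma round_cmb x y : exists m k : int,
  qnormsq (cmb x y - cmb m%:~R k%:~R) <= 2^-1.
Proof.
have [k kP] := round_half y; have [m mP] := round_half (x + c * (y - k%:~R)).
exists m, k.
have -> : cmb x y - cmb m%:~R k%:~R = cmb (x - m%:~R) (y - k%:~R).
  by rewrite !scalerBl opprD addrACA.
rewrite qnormsq_cmb; move: kP mP; rewrite addrAC.
move: (y - _) (x - _) => b a; rewrite !ler_norml => /andP[b1 b2] /andP[a1 a2].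
have -> : a ^+ 2 + 2 * c * a * b + b ^+ 2 =
   (a + c * b) ^+ 2 + (1 - c ^+ 2) * b ^+ 2 by ring.
have hb : b ^+ 2 <= 4^-1 by nra.
have ha : (a + c * b) ^+ 2 <= 4^-1 by move: (a + c * b) a1 a2 => d; nra.
have hc : (1 - c ^+ 2) * b ^+ 2 <= b ^+ 2.
  by rewrite ler_piMl ?sqr_ge0// gerBl sqr_ge0.
by lra.
Qed.

Definition off_slice q := lat_set M q /\ perp q != 0.

(** The lattice spans a space of dimension [4], the slice has dimension [2]. *)
Lemma off_slice_ex : exists q, off_slice q.
Proof.
have [v [vf Mv]] := lat_basis M.
apply: contrapT => H.
have vC i : perp (tnth v i) = 0.
  apply: contrapT => /eqP h; apply: H; exists (tnth v i); split=> //.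
  rewrite Mv; exists (fun j => (j == i)%:R); rewrite (bigD1 i)//= eqxx mulr1z.
  by rewrite big1 ?addr0// => j /negPf->; rewrite mulr0z.
have sub : (<<v>> <= <<[:: 1%R : quat R; e]>>)%VS.
  apply/span_subvP => _ /tnthP[i ->].
  have [x [y ->]] := perp_eq0_cmb (vC i).
  by apply: memvD; apply: memvZ; apply: memv_span; rewrite !inE eqxx ?orbT.
have := dimvS sub; rewrite (eqnP vf) size_tuple => h.
by have := leq_trans h (dim_span _).
Qed.

Definition shortest_off_slice al := off_slice al /\
  forall q, off_slice q -> qnormsq al <= qnormsq q.

Lemma shortest_off_slice_ex : exists al, shortest_off_slice al.
Proof.
have [q0 [Mq0 oq0]] := off_slice_ex.
have [al [Mal oal H]] := @lattice_shortest _ M (fun q => perp q != 0)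
  (ex_intro2 _ _ q0 Mq0 oq0).
by exists al; split=> // q [Mq oq]; exact: H.
Qed.

Lemma off_slice_ge1 q : off_slice q -> 1 <= qnormsq q.
Proof.
move=> [Mq oq]; apply: Mmin => //; apply: contraNneq oq => ->.
by rewrite /perp mulr0 mul0r addr0.
Qed.

(** Division with remainder by [al], for the component orthogonal to the
    slice, followed by division by [1] in the slice. *)
Lemma reduce_mod al v : off_slice al -> lat_set M v -> exists m k m' k' : int,
  let v2 := v - al * cmb m%:~R k%:~R - cmb m'%:~R k'%:~R in
  [/\ lat_set M v2, qnormsq (par v2) <= 2 &
      qnormsq (perp v2) <= qnormsq (perp al) / 2].
Proof.
move=> [Mal oal] Mv; have [w wI vw] := perp_quotient I2 v oal.
have [x [y wE]] := perp_eq0_cmb (perp_comm I2 wI).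
have [m [k mk]] := round_cmb x y.
pose v1 := v - al * cmb m%:~R k%:~R.
have /perp_eq0_cmb [x' [y' pE]] : perp (2^-1 *: par v1) = 0.
  apply: perp_comm => //; rewrite par_slice// -scalerAl -scalerAr.
  by rewrite mulrDl mulrDr -!scalerAl -!scalerAr mul1r mulr1.
have [m' [k' mk']] := round_cmb x' y'.
exists m, k, m', k'; split.
- by apply: latB; [apply: latB => //; exact: lat_mulr_cmb|exact: lat_cmb].
- rewrite -/v1 parB (par_comm I2 (cmb_comm _ _)).
  have -> : par v1 = 2 *: (2^-1 *: par v1).
    by rewrite scalerA divff ?pnatr_eq0// scale1r.
  rewrite pE -scalerBr qnormsqZ; lra.
- rewrite -/v1 perpB perp_cmb subr0 /v1 perpB (perp_mulr _ (cmb_comm _ _)).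
  by rewrite vw wE -mulrBr qnormsqM ler_wpM2l ?qnormsq_ge0.
Qed.

(** If the remainder [q] of a division by [al] is not in the slice, then
    [4 |al|^2 <= 4 |q|^2 <= 2 + |perp al|^2 / 2 <= 2 + 2 |al|^2], so [al] is a
    unit vector orthogonal to the slice, and [q] is another shortest vector,
    not orthogonal to the slice. This happens, for instance, when [al = j] in
    the Hurwitz order. Hence a shortest vector whose component orthogonal to
    the slice is not of norm [1] will do, and if there is none the situation
    cannot occur. *)
Lemma reduced_gap : exists2 al, shortest_off_slice al &
  forall q, off_slice q -> qnormsq (par q) <= 2 ->
    qnormsq (perp q) <= qnormsq (perp al) / 2 -> False.
Proof.
have bounds al q : shortest_off_slice al -> off_slice q -> qnormsq (par q) <= 2 ->
    qnormsq (perp q) <= qnormsq (perp al) / 2 ->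
    [/\ qnormsq (perp al) = 4, shortest_off_slice q & qnormsq (perp q) <= 2].
  move=> [oal sal] oq hp hq.
  have al1 := off_slice_ge1 oal; have alq := sal q oq.
  have := qnormsq_par_perp I2 al; have := qnormsq_par_perp I2 q => hNq hNal.
  have p0 := qnormsq_ge0 (par al).
  split; [lra| |lra]; split=> // q' oq'.
  by apply: le_trans (sal q' oq'); lra.
have [[al [sal h]]|H] := pselect (exists al, shortest_off_slice al /\ qnormsq (perp al) <> 4).
  by exists al => // q oq hp hq; have [] := bounds al q sal oq hp hq.
have [al sal] := shortest_off_slice_ex; exists al => // q oq hp hq.
have [_ sq q2] := bounds al q sal oq hp hq.
apply: H; exists q; split=> // h; lra.
Qed.

Section Basis.
Variable al : quat R.
Hypothesis sal : shortest_off_slice al.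
Hypothesis gap : forall q, off_slice q -> qnormsq (par q) <= 2 ->
  qnormsq (perp q) <= qnormsq (perp al) / 2 -> False.
Hypothesis sgn : 0 <= qdot e al.

Local Notation T := [tuple 1; e; al; al * e].

Lemma sum_ord4 (V : nmodType) (F : 'I_4 -> V) : \sum_(i < 4) F i =
  F (inord 0) + F (inord 1) + F (inord 2) + F (inord 3).
Proof.
rewrite !big_ord_recl big_ord0 addr0 !addrA.
by congr (F _ + F _ + F _ + F _); apply/val_inj; rewrite /= inordK.
Qed.

Lemma tuple4E : [/\ tnth T (inord 0) = 1, tnth T (inord 1) = e,
  tnth T (inord 2) = al & tnth T (inord 3) = al * e].
Proof. by split; rewrite (tnth_nth 0) inordK. Qed.

Lemma basis_sum (k : 'I_4 -> R) : \sum_(i < 4) k i *: tnth T i =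
  cmb (k (inord 0)) (k (inord 1)) + al * cmb (k (inord 2)) (k (inord 3)).
Proof.
rewrite sum_ord4; have [-> -> -> ->] := tuple4E.
by rewrite mulrDr -!scalerAr mulr1 !addrA.
Qed.

Lemma perp_basis_sum x y z t : perp (cmb x y + al * cmb z t) = perp al * cmb z t.
Proof. by rewrite perpD perp_cmb add0r (perp_mulr _ (cmb_comm _ _)). Qed.

Lemma perp_basis_sum_eq0 x y z t : perp (cmb x y + al * cmb z t) = 0 ->
  z = 0 /\ t = 0.
Proof.
have [[_ oal] _] := sal.
rewrite perp_basis_sum => /eqP; rewrite qmul_eq0 (negPf oal) => /eqP.
exact: cmb_eq0.
Qed.

Lemma basis_sum_eq0 x y z t : cmb x y + al * cmb z t = 0 ->
  [/\ x = 0, y = 0, z = 0 & t = 0].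
Proof.
move=> h; have [z0 t0] : z = 0 /\ t = 0.
  by apply: (@perp_basis_sum_eq0 x y); rewrite h /perp mulr0 mul0r addr0.
move: h; rewrite z0 t0 !scale0r addr0 mulr0 addr0 => h.
by have [] := cmb_eq0 h.
Qed.

Lemma basis_free : free T.
Proof.
apply/freeP => k; under eq_bigr => i _ do rewrite -(tnth_nth 0).
rewrite basis_sum => /basis_sum_eq0[h0 h1 h2 h3] i.
by case: i => [[|[|[|[|//]]]] lti]; rewrite -[Ordinal lti]inord_val.
Qed.

Lemma lat_basis_sum (n : 'I_4 -> int) : lat_set M (\sum_(i < 4) tnth T i *~ n i).
Proof.
have [[Mal _] _] := sal.
under eq_bigr => i _ do rewrite -scaler_int.
rewrite basis_sum; apply: latD; first exact: lat_cmb.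
exact: lat_mulr_cmb.
Qed.

Lemma basis_spans : lat_set M = zspan T.
Proof.
apply/seteqP; split=> [v Mv|_ [n ->]]; last exact: lat_basis_sum.
have [m [k [m' [k' [Mv2 p2 q2]]]]] := reduce_mod sal.1 Mv.
set v2 := v - _ - _ in Mv2 p2 q2.
have pv2 : perp v2 = 0.
  by apply/eqP; apply: contrapT => /negP h; exact: (gap (conj Mv2 h)).
have v20 : v2 = 0.
  apply: contrapT => /eqP/(Mmin Mv2) h.
  have := qnormsq_par_perp I2 v2; rewrite pv2.
  have -> : qnormsq (0 : quat R) = 0 by apply/eqP; rewrite qnormsq_eq0.
  lra.
exists (fun i => nth 0 [:: m'; k'; m; k] i).
under eq_bigr => i _ do rewrite -scaler_int.
rewrite basis_sum !inordK//=.
by move/eqP: v20; rewrite /v2 subr_eq0 subr_eq => /eqP.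
Qed.

Lemma gram_quadratic (v : 4.-tuple (quat R)) (m : 'rV[R]_4) :
  (m *m gram v *m m^T) 0 0 = qnormsq (\sum_i m 0 i *: tnth v i).
Proof.
have sumL (a : 'I_4 -> R) w : qdot (\sum_i a i *: tnth v i) w =
    \sum_i a i * qdot (tnth v i) w.
  rewrite (big_morph (fun q => qdot q w) (id1 := 0) (op1 := +%R)).
  - by apply: eq_bigr => i _; exact: qdotZl.
  - by move=> p q; exact: qdotDl.
  - by rewrite qdotE !quatE; ring.
rewrite /qnormsq sumL mxE; under eq_bigr => j _ do rewrite !mxE mulr_suml.
rewrite exchange_big; apply: eq_bigr => i _ /=.
rewrite qdotC sumL mulr_sumr; apply: eq_bigr => j _.
by rewrite !mxE qdotC; ring.
Qed.

(** An integral combination with a nonzero coefficient of index at least [k]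
    is nonzero, and if [2 <= k] it is not in the slice; so its norm is at least
    that of [1] and [e], respectively that of [al] and [al e]. *)
Lemma basis_reduced : reduced_gram (gram T).
Proof.
have [t0 t1 t2 t3] := tuple4E.
have Nal1 := off_slice_ge1 sal.1.
split=> [i j|k n gcd1 /=].
  case: i => [[|[|[|[|//]]]] lti]; case: j => [[|[|[|[|//]]]] ltj] //= _;
    rewrite mxE -[Ordinal lti]inord_val -[Ordinal ltj]inord_val /= ?t0 ?t1 ?t2 ?t3.
  - have -> : qdot 1 e = qre e by rewrite qdotE !quatE; ring.
    by rewrite re_e; have /andP[] := c01.
  - exact: sgn.
  - have -> : qdot al (al * e) = qnormsq al * qre e.
      by rewrite qnormsqE qdotE !quatE; ring.
    by rewrite re_e mulr_ge0 ?qnormsq_ge0//; have /andP[] := c01.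
rewrite gram_quadratic.
have [i ki ni] : exists2 i : 'I_4, (k <= i)%N & n ord0 i != 0.
  apply: contrapT => H; move: gcd1; rewrite big1 // => i ki.
  apply/eqP; rewrite absz_eq0; apply: contrapT => /negP ni.
  by apply: H; exists i.
set q := \sum_i _.
have qE : q = \sum_i tnth T i *~ n ord0 i.
  by apply: eq_bigr => j _; rewrite mxE scaler_int.
have Mq : lat_set M q by rewrite qE; exact: lat_basis_sum.
have qS : q = cmb (n ord0 (inord 0))%:~R (n ord0 (inord 1))%:~R +
    al * cmb (n ord0 (inord 2))%:~R (n ord0 (inord 3))%:~R.
  by rewrite /q basis_sum !mxE.
have q_ge1 : 1 <= qnormsq q.
  apply: Mmin => //; apply: contra_neq ni => q0.
  move: q0; rewrite qS => /basis_sum_eq0[/eqP h0 /eqP h1 /eqP h2 /eqP h3].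
  rewrite !intr_eq0 in h0 h1 h2 h3; apply/eqP.
  by case: i ki => [[|[|[|[|//]]]] lti] _; rewrite -[Ordinal lti]inord_val.
have q_al : (2 <= k)%N -> qnormsq al <= qnormsq q.
  move=> k2; apply: sal.2; split=> //; apply: contra_neq ni => q0.
  move: q0; rewrite qS => /perp_basis_sum_eq0[/eqP h2 /eqP h3].
  rewrite !intr_eq0 in h2 h3; apply/eqP; have := leq_trans k2 ki.
  by case: i ki => [[|[|[|[|//]]]] lti] _ //= _; rewrite -[Ordinal lti]inord_val.
rewrite mxE; case: k q_al {ki gcd1} => [[|[|[|[|//]]]] ltk] /= q_al;
  rewrite -[Ordinal ltk]inord_val ?t0 ?t1 ?t2 ?t3 -/(qnormsq _).
- by rewrite qnormsq1.
- by rewrite Ne.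
- exact: q_al.
- by rewrite qnormsqM Ne mulr1; exact: q_al.
Qed.

Lemma basis_special : special_basis T.
Proof. by split; [exact: basis_free|exact: basis_reduced|]. Qed.

End Basis.

Lemma reduced_basis_ex : exists al, [/\ 1 <= qnorm al,
  special_basis [tuple 1; e; al; al * e] &
  lat_set M = zspan [tuple 1; e; al; al * e]].
Proof.
have [al sal gap] := reduced_gap.
have [sgn|sgn] := leP 0 (qdot e al).
  exists al; split; [|exact: basis_special|exact: basis_spans].
  by rewrite qnorm_ge1; exact: off_slice_ge1 sal.1.
have sal' : shortest_off_slice (- al).
  have [[Mal oal] h] := sal; split; first by split; [exact: latN|rewrite perpN oppr_eq0].
  by move=> q oq; rewrite qnormsqN; exact: h.
have gap' q : off_slice q -> qnormsq (par q) <= 2 ->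
    qnormsq (perp q) <= qnormsq (perp (- al)) / 2 -> False.
  by rewrite perpN qnormsqN; exact: gap.
have sgn' : 0 <= qdot e (- al) by rewrite qdotNr oppr_ge0 ltW.
exists (- al); split; [|exact: basis_special|exact: basis_spans].
by rewrite qnorm_ge1; exact: off_slice_ge1 sal'.1.
Qed.

End ReducedBasis.

(** * The quaternionic exponential *)

Section QuaternionExponential.
Variable R : realType.
Implicit Types (p q I J : quat R) (x y : R).

Lemma qexpE x I : qexp x I = (cos x)%:A + sin x *: I. Proof. by []. Qed.

Lemma qexpD x y I : I ^+ 2 = -1 -> qexp x I * qexp y I = qexp (x + y) I.
Proof.
move=> I2; rewrite !qexpE cosD sinD; move: (cos x) (cos y) (sin x) (sin y) => c d s t.
have -> : (c%:A + s *: I) * (d%:A + t *: I) =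
    (c * d)%:A + (s * t) *: (I * I) + (s * d + c * t) *: I.
  by apply: quatP; rewrite !quatE; ring.
by rewrite -expr2 I2 scalerN -scalerBl.
Qed.

Lemma qexpX x I k : I ^+ 2 = -1 -> qexp x I ^+ k = qexp (k%:R * x) I.
Proof.
move=> I2; elim: k => [|k ih].
  by rewrite expr0 mul0r qexpE cos0 sin0 scale0r addr0 scale1r.
by rewrite exprSr ih qexpD// -natr1 mulrDl mul1r.
Qed.

Lemma qexp_coords x I : I ^+ 2 = -1 ->
  qre (qexp x I) = cos x /\ qdot (qexp x I) I = sin x.
Proof.
move=> /imag_unitE[I0 I1]; rewrite qexpE; split; first by rewrite !quatE I0; ring.
have -> : qdot ((cos x)%:A + sin x *: I) I = sin x * qnormsq I.
  by rewrite qdotE qnormsqE !quatE I0; ring.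
by rewrite I1 mulr1.
Qed.

Lemma qnormsq_qexp x I : I ^+ 2 = -1 -> qnormsq (qexp x I) = 1.
Proof.
move=> /imag_unitE[I0 I1]; rewrite qexpE.
have -> : qnormsq ((cos x)%:A + sin x *: I) = cos x ^+ 2 + sin x ^+ 2 * qnormsq I.
  by rewrite !qnormsqE !quatE I0; ring.
by rewrite I1 mulr1 cos2Dsin2.
Qed.

(** For [c = cos (pi / 3)], the formula for the cosine of a triple angle gives
    [(c + 1) (2 c - 1) ^ 2 = cos pi + 1 = 0]. *)
Lemma cos_pi3 : cos (pi / 3) = 2^-1 :> R.
Proof.
have h3 : cos (pi / 3 + pi / 3 + pi / 3) = -1 :> R.
  by rewrite -cospi; congr cos; field.
have p0 := pi_gt0 R.
have c0 : 0 < cos (pi / 3 : R) by apply: cos_gt0_pihalf; apply/andP; split; lra.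
have := cos2Dsin2 (pi / 3 : R); move: h3; rewrite !cosD sinD.
move: (cos _) (sin _) c0 => c s c0 h3 h.
have h4 : (c + 1) * (2 * c - 1) ^+ 2 = 0.
  have -> : (c + 1) * (2 * c - 1) ^+ 2 = 4 * c ^+ 3 - 3 * c + 1 by ring.
  have s2 : s ^+ 2 = 1 - c ^+ 2 by rewrite -h addrAC subrr add0r.
  have : c ^+ 3 - 3 * c * s ^+ 2 = -1 by rewrite -h3; ring.
  rewrite s2 => h5; have := h5; nra.
move/eqP: h4; rewrite mulf_eq0 sqrf_eq0 gt_eqF ?addr_gt0//= => /eqP h4.
by lra.
Qed.

Lemma sin_pi3_gt0 : 0 < sin (pi / 3) :> R.
Proof. by have p0 := pi_gt0 R; apply: sin_gt0_pi; apply/andP; split; lra. Qed.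

Lemma qexp_pihalf I : qexp (pi / 2) I = I.
Proof. by rewrite qexpE cos_pihalf sin_pihalf scale0r add0r scale1r. Qed.

End QuaternionExponential.

(** * Lattices with nontrivial automorphisms *)

Section Automorphisms.
Variable R : realType.
Implicit Types (L : lattice R) (a b p q I J : quat R).

Definition preserves L a := forall q, lat_set L q <-> lat_set L (q * a).

Lemma preservesX L a k : preserves L a -> preserves L (a ^+ k).
Proof.
move=> La; elim: k => [|k ih] q; first by rewrite expr0 mulr1.
by rewrite exprSr mulrA; apply: iff_trans (ih q) (La _).
Qed.

Lemma Aut_mulr L a : qnormsq a = 1 ->
  Aut L (fun q => q * a) <-> preserves L a.
Proof.
move=> Na; have a0 : a != 0 by rewrite -qnormsq_eq0 Na oner_neq0.
split=> [[b _ [Fb FL]]|La].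
  move=> q; split=> [Lq|]; first by rewrite -[lat_set L]FL; exists q.
  by rewrite -[X in X (_ * a)]FL => -[p Lp /(qmulIr a0) <-].
exists a; first exact/qnorm_eq1.
split=> //; apply/seteqP; split=> [_ [p /La Lp <-]//|q Lq].
exists (q * qinv a); last by rewrite -mulrA qmulVl// mulr1.
by apply/La; rewrite -mulrA qmulVl// mulr1.
Qed.

Lemma pm1_Aut L : pm1 R `<=` Aut L.
Proof.
have E1 : (fun q : quat R => q) = (fun q => q * 1).
  by apply/funext => q; rewrite mulr1.
have E2 : (fun q : quat R => - q) = (fun q => q * -1).
  by apply/funext => q; rewrite mulrN1.
move=> F [->|->]; [rewrite E1|rewrite E2]; apply/Aut_mulr.
- exact: qnormsq1.
- by move=> q; rewrite mulr1.
- by rewrite qnormsqN qnormsq1.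
- move=> q; rewrite mulrN1; split; first exact: latN.
  by move=> /latN; rewrite opprK.
Qed.

Lemma Aut_nontrivial L : Aut L <> pm1 R <->
  exists a, [/\ qnormsq a = 1, preserves L a, a <> 1 & a <> -1].
Proof.
split=> [H|[a [Na La a1 aN1]] E].
  apply: contrapT => H2; apply: H; apply/seteqP; split; last exact: pm1_Aut.
  move=> _ [a /qnorm_eq1 Na [-> FL]].
  have [->|a1] := pselect (a = 1); first by left; apply/funext => q; rewrite mulr1.
  have [->|aN1] := pselect (a = -1); first by right; apply/funext => q; rewrite mulrN1.
  exfalso; apply: H2; exists a; split=> //; apply/Aut_mulr => //.
  by exists a => //; exact/qnorm_eq1.
have : Aut L (fun q => q * a) by exact/Aut_mulr.
rewrite E => -[] /(congr1 (@^~ 1)); rewrite mul1r; first exact: a1.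
exact: aN1.
Qed.

Lemma scaled_lattice L b b' : b * b' = 1 -> b' * b = 1 ->
  exists M : lattice R, forall q, lat_set M q <-> lat_set L (q * b').
Proof.
move=> bb' b'b; have [v [vf Lv]] := lat_basis L.
have b0 : b != 0.
  by apply/eqP => b0; move/eqP: bb'; rewrite b0 mul0r eq_sym oner_eq0.
pose w := [tuple tnth v i * b | i < 4].
have wf : free w.
  apply/freeP => k; under eq_bigr => i _ do
    rewrite -(tnth_nth 0) tnth_mktuple scalerAl (tnth_nth 0).
  rewrite -mulr_suml => /eqP; rewrite qmul_eq0 (negPf b0) orbF => /eqP.
  exact: freeP vf k.
exists (@Lattice R (zspan w) (ex_intro _ w (conj wf erefl))) => q /=.
rewrite Lv; split=> [[n ->]|[n qE]].
  exists n; rewrite mulr_suml; apply: eq_bigr => i _.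
  by rewrite tnth_mktuple -mulrzAl -mulrA bb' mulr1.
exists n; rewrite -[q]mulr1 -b'b mulrA qE mulr_suml; apply: eq_bigr => i _.
by rewrite tnth_mktuple mulrzAl.
Qed.

(** After division by a shortest vector, the conjugate [b] of [a] lies in the
    lattice, and so does the real number [2 Re b], which must be an integer
    since [1] has become a shortest vector. *)
Lemma nontrivial_type L a : qnormsq a = 1 -> preserves L a -> a <> 1 -> a <> -1 ->
  type1 L \/ type2 L.
Proof.
move=> Na La a1 aN1.
have [v [Lv v0 vmin]] : exists v, [/\ lat_set L v, v != 0 &
    forall q, lat_set L q -> q != 0 -> qnormsq v <= qnormsq q].
  apply: lattice_shortest; have [w [wf ->]] := lat_basis L.
  exists (tnth w 0).
    exists (fun j => (j == 0)%:R); rewrite (bigD1 0)//= mulr1z.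
    by rewrite big1 ?addr0// => j /negPf->; rewrite mulr0z.
  apply/eqP => w0; have := @coord_free _ _ _ w 0 0 wf.
  by rewrite -(tnth_nth 0) w0 linear0 eqxx => /esym/eqP; rewrite oner_eq0.
have [M MP] := @scaled_lattice L (qinv v) v (qmulVl v0) (qmulV v0).
have Nv : 0 < qnormsq v by rewrite qnormsq_gt0.
have M1 : lat_set M 1 by apply/MP; rewrite mul1r.
have Mmin q : lat_set M q -> q != 0 -> 1 <= qnormsq q.
  move=> /MP Lq q0; have := vmin _ Lq; rewrite qmul_eq0 (negPf q0) (negPf v0)/=.
  by rewrite qnormsqM ler_pMl//; exact.
have LM : equivalent_tori L M.
  apply: (similar_equivalent_tori (qmulVl v0) (qmulV v0)) => q.
  apply: iff_sym; apply: iff_trans (MP _) _.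
  by rewrite -mulrA qmulVl// mulr1.
pose b := v * a * qinv v.
have Mb : preserves M b.
  move=> q; apply: iff_trans (MP q) _; apply: iff_sym; apply: iff_trans (MP _) _.
  rewrite /b -!mulrA qmulVl// mulr1 [q * _]mulrA; exact: iff_sym (La _).
have Nb : qnormsq b = 1.
  by rewrite /b !qnormsqM Na mulr1 -qnormsqM qmulV// qnormsq1.
have ab : a = qinv v * b * v.
  by rewrite /b !mulrA qmulVl// mul1r -mulrA qmulVl// mulr1.
have b1 : b <> 1 by move=> b1; apply: a1; rewrite ab b1 mulr1 qmulVl.
have bN1 : b <> -1.
  by move=> bN1; apply: aN1; rewrite ab bN1 mulrN1 mulNr qmulVl.
clearbody b.
have Mtr : lat_set M (2 * qre b)%:A.
  have -> : (2 * qre b)%:A = b + qconj b :> quat R.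
    by apply: quatP; rewrite !quatE; ring.
  apply: latD; first by rewrite -[b]mul1r; apply/(Mb 1).
  by apply/Mb; rewrite qconj_mul Nb scale1r.
have [n nE] : exists n : int, 2 * qre b = n%:~R.
  exists (Num.floor (2 * qre b)); apply/eqP; rewrite -subr_eq0.
  have /andP[] := floor_itv (2 * qre b); rewrite intrD.
  move: (2 * qre b) Mtr => x Mx; move: (Num.floor x) => n h1 h2.
  apply: contrapT => /negP h; have : 1 <= qnormsq ((x - n%:~R)%:A : quat R).
    apply: Mmin; last by rewrite -qnormsq_eq0 qnormsqA sqrf_eq0.
    by rewrite scalerBl scaler_int; apply: latB => //; exact: lat_mulz.
  rewrite qnormsqA; nra.
have re_lt : qre b ^+ 2 < 1.
  have := Nb; rewrite qnormsqE => Nb'.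
  have [h1 h2 h3] := And3 (sqr_ge0 (qi b)) (sqr_ge0 (qj b)) (sqr_ge0 (qk b)).
  rewrite lt_neqAle; apply/andP; split; last lra.
  apply/negP => /eqP re1.
  have /eqP : qi b ^+ 2 + qj b ^+ 2 + qk b ^+ 2 = 0 by lra.
  rewrite !paddr_eq0 ?addr_ge0// !sqrf_eq0 => /andP[/andP[/eqP hi /eqP hj] /eqP hk].
  move/eqP: re1; rewrite sqrf_eq1 => /orP[]/eqP hr.
    by apply: b1; apply: quatP; rewrite !quatE.
  by apply: bN1; apply: quatP; rewrite !quatE ?oppr0.
have n1 : n = 0 \/ n = 1 \/ n = -1.
  have : (n%:~R : R) ^+ 2 < 4 by rewrite -nE exprMn; lra.
  have -> : (n%:~R : R) ^+ 2 = (n ^+ 2)%:~R by rewrite rmorphXn.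
  rewrite -[4]/(4%:~R) ltr_int; nia.
have [e [Me Ne re_e]] : exists e, [/\ preserves M e, qnormsq e = 1 &
    qre e = 0 \/ qre e = 2^-1].
  case: n1 nE => [->|[->|->]] nE.
  - by exists b; split=> //; left; lra.
  - by exists b; split=> //; right; lra.
  - exists (- b); split; last by right; rewrite quatNE; lra.
    + move=> q; apply: iff_trans (Mb q) _; rewrite mulrN.
      by split=> /latN; rewrite ?opprK.
    + by rewrite qnormsqN.
have Me' q : lat_set M q -> lat_set M (q * e) by move/Me.
case: re_e => re_e; [left|right].
- have e2 : e ^+ 2 = -1 by apply/imag_unitE.
  have eE : e = 0%:A + 1 *: e by rewrite scale0r add0r scale1r.
  have c01 : 0 <= (0 : R) <= 2^-1 by rewrite lexx invr_ge0 ler0n.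
  have [al [al1 sp ME]] := reduced_basis_ex e2 eE (oner_neq0 _) Ne c01 M1 Me' Mmin.
  by exists e, al; split=> //; exists M.
- pose s : R := sin (pi / 3); have s0 : 0 < s by exact: sin_pi3_gt0.
  pose I := s^-1 *: (e - 2^-1%:A).
  have eE : e = 2^-1%:A + s *: I.
    by rewrite /I scalerA divff ?gt_eqF// scale1r addrC subrK.
  have I2 : I ^+ 2 = -1.
    apply/imag_unitE; rewrite /I; split.
      by rewrite !quatE re_e mulr1 subrr mulr0.
    rewrite qnormsqZ.
    have -> : qnormsq (e - 2^-1%:A) = qnormsq e - qre e + 2^-1 ^+ 2.
      by rewrite !qnormsqE !quatE re_e; field.
    have s2 : s ^+ 2 = 1 - 2^-1 ^+ 2.
      by have := cos2Dsin2 (pi / 3 : R); rewrite cos_pi3 -/s => h; lra.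
    have -> : qnormsq e - qre e + 2^-1 ^+ 2 = s ^+ 2 by rewrite Ne re_e s2; field.
    by rewrite exprVn mulVf// expf_neq0// gt_eqF.
  have eX : e = qexp (pi / 3) I by rewrite qexpE cos_pi3.
  have c01 : 0 <= (2^-1 : R) <= 2^-1 by rewrite lexx invr_ge0 ler0n.
  have [al [al1 sp ME]] := reduced_basis_ex I2 eE (lt0r_neq0 s0) Ne c01 M1 Me' Mmin.
  by exists I, al; rewrite /= -eX; split=> //; exists M.
Qed.

End Automorphisms.

(** * Cyclic groups of automorphisms *)

Section CyclicSubgroups.
Variable R : realType.
Implicit Types (L : lattice R) (a p q I J : quat R).

(** The real algebra morphism from [R + R I] to [R + R J] sending [I] to [J]. *)
Definition transfer I J p : quat R := (qre p)%:A + qdot p I *: J.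

Lemma transfer_qexp I J x : I ^+ 2 = -1 -> transfer I J (qexp x I) = qexp x J.
Proof. by move=> I2; rewrite /transfer; have [-> ->] := qexp_coords x I2. Qed.

(** The subgroup consists of the multiplications by powers of
    [exp (pi J / n)]. Inverses are again such powers because the order of this
    element divides [2 n]. *)
Lemma preserves_subgroup L n J : (0 < n)%N -> J ^+ 2 = -1 ->
  preserves L (qexp (pi / n%:R) J) ->
  forall I, imag_units I -> has_subgroup_isom (Aut L) (cyclic2 n I).
Proof.
move=> n0 J2 LJ I I2.
pose zeta K : quat R := qexp (pi / n%:R) K.
have zetaX K k : K ^+ 2 = -1 -> zeta K ^+ k = qexp (k%:R * (pi / n%:R)) K.
  by move=> K2; rewrite qexpX.
have N1 k : qnormsq (zeta J ^+ k) = 1 by rewrite zetaX// qnormsq_qexp.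
have order_zeta : zeta J ^+ (n.*2) = 1.
  have nn : n%:R != 0 :> R by rewrite pnatr_eq0 -lt0n.
  have E : n.*2%:R * (pi / n%:R) = pi + pi :> R.
    by rewrite -muln2 natrM; field.
  rewrite zetaX// E qexpE cosD sinD sinpi cospi !(mulr0, mul0r, addr0, subr0).
  by rewrite mulrNN mulr1 scale1r scale0r addr0.
have tr k : transfer I J (zeta I ^+ k) = zeta J ^+ k.
  by rewrite !zetaX// transfer_qexp.
have trV k : transfer J I (zeta J ^+ k) = zeta I ^+ k.
  by rewrite !zetaX// transfer_qexp.
exists [set F | exists k : nat, F = (fun q => q * zeta J ^+ k)]; split.
- by move=> _ [k ->]; apply/Aut_mulr => //; exact: preservesX.
- split.
  + by exists 0%N; apply/funext => q; rewrite expr0 mulr1.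
  + move=> _ _ [k ->] [m ->]; exists (m + k)%N.
    by apply/funext => q /=; rewrite exprD mulrA.
  + move=> _ [k ->].
    have E1 : zeta J ^+ k * zeta J ^+ (k * n.*2.-1) = 1.
      rewrite -exprD -mulnS prednK ?double_gt0// mulnC exprM order_zeta.
      exact: expr1n.
    have E2 : zeta J ^+ (k * n.*2.-1) * zeta J ^+ k = 1.
      by rewrite -exprD addnC exprD.
    exists (fun q => q * zeta J ^+ (k * n.*2.-1)); split.
    * by exists (k * n.*2.-1)%N.
    * by move=> q; rewrite -mulrA E1 mulr1.
    * by move=> q; rewrite -mulrA E2 mulr1.
- exists (fun p q => q * transfer I J p); split; first split.
  + by move=> _ [k ->]; exists k; rewrite -tr.
  + move=> _ _ /set_mem[k ->] /set_mem[m ->] /(congr1 (@^~ 1)).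
    rewrite !mul1r -!/(zeta I) !tr => /(congr1 (transfer J I)).
    by rewrite !trV.
  + move=> _ [k ->]; exists (zeta I ^+ k); first by exists k.
    by rewrite tr.
  + move=> _ _ [k ->] [m ->]; apply/funext => q /=.
    by rewrite -!/(zeta I) -exprD !tr -mulrA -exprD addnC.
Qed.

Lemma mulr_quadratic (e al : quat R) (m x y z t : R) : e ^+ 2 = m *: e - 1 ->
  (x *: 1 + y *: e + z *: al + t *: (al * e)) * e =
  (- y) *: 1 + (x + m * y) *: e + (- t) *: al + (z + m * t) *: (al * e).
Proof.
rewrite expr2 => e2.
have E : al * e * e = m *: (al * e) - al.
  by rewrite -mulrA e2 mulrBr mulr1 -scalerAr.
have -> : (x *: 1 + y *: e + z *: al + t *: (al * e)) * e =
    x *: e + y *: (e * e) + z *: (al * e) + t *: (al * e * e).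
  by rewrite !mulrDl -!scalerAl mul1r.
rewrite E e2; move: (al * e) => u.
by apply: quatP; rewrite !quatE; ring.
Qed.

(** The inverse [n - e] of [e] is in [Z[e]], so it suffices that the span is a
    right module over [Z[e]]. *)
Lemma span_preserves (L : lattice R) (e al : quat R) (n : int) : e ^+ 2 = e *~ n - 1 ->
  lat_set L = zspan [tuple 1; e; al; al * e] -> preserves L e.
Proof.
move=> e2 LE.
have [t0 t1 t2 t3] := tuple4E e al.
have sumE (k : 'I_4 -> int) :
    \sum_(i < 4) tnth [tuple 1; e; al; al * e] i *~ k i =
    (k (inord 0))%:~R *: 1 + (k (inord 1))%:~R *: e + (k (inord 2))%:~R *: al +
      (k (inord 3))%:~R *: (al * e).
  by rewrite sum_ord4 t0 t1 t2 t3 !scaler_int.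
have fwd q : lat_set L q -> lat_set L (q * e).
  rewrite LE => -[k ->].
  exists (fun i => nth 0 [:: - k (inord 1); k (inord 0) + n * k (inord 1);
    - k (inord 3); k (inord 2) + n * k (inord 3)] i).
  have e2' : e ^+ 2 = n%:~R *: e - 1 by rewrite scaler_int.
  rewrite !sumE !inordK//= (mulr_quadratic _ _ _ _ _ e2').
  by rewrite !intrD !intrN !intrM.
move=> q; split; first exact: fwd.
move=> Lq; have -> : q = (q * e) *~ n - (q * e) * e.
  by rewrite -!mulrA -expr2 e2 mulrBr mulr1 mulrzAr opprB addrCA subrr addr0.
by apply: latB; [exact: lat_mulz|exact: fwd].
Qed.

(** The similarity [q |-> q a] from [L] to the lattice with the special basis
    conjugates the multiplication by [exp (x I)] on the latter to the
    multiplication by [exp (x (a I a^-1))] on [L]. *)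
Lemma corresponds_preserves L I al x (n : int) : I ^+ 2 = -1 ->
  qexp x I ^+ 2 = qexp x I *~ n - 1 ->
  corresponds L (qexp x I, al, al * qexp x I) ->
  exists2 J, J ^+ 2 = -1 & preserves L (qexp x J).
Proof.
move=> I2 e2 [L' /= L'E /equivalent_tori_similar[a [a' [aa' a'a LL']]]].
have Le := span_preserves e2 L'E.
exists (a * I * a').
  by rewrite expr2 -!mulrA (mulrA a') a'a mul1r (mulrA I) -expr2 I2 mulN1r mulrN aa'.
have -> : qexp x (a * I * a') = a * qexp x I * a'.
  rewrite !qexpE mulrDr mulrDl -!scalerAr -!scalerAl mulr1.
  by rewrite aa'.
move=> q; apply: iff_trans (LL' q) _; apply: iff_trans (Le _) _.
apply: iff_sym; apply: iff_trans (LL' _) _.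
by rewrite -!mulrA a'a mulr1.
Qed.

Lemma type1_preserves L : type1 L ->
  exists2 J, J ^+ 2 = -1 & preserves L (qexp (pi / 2) J).
Proof.
move=> [I [al [I2 _ _ cor]]].
apply: (@corresponds_preserves L I al (pi / 2) 0) => //.
  by rewrite qexp_pihalf I2 mulr0z add0r.
by rewrite qexp_pihalf.
Qed.

Lemma type2_preserves L : type2 L ->
  exists2 J, J ^+ 2 = -1 & preserves L (qexp (pi / 3) J).
Proof.
move=> [I [al [I2 _ _ cor]]].
apply: (@corresponds_preserves L I al (pi / 3) 1) => //.
have s2 : sin (pi / 3 : R) ^+ 2 = 3 / 4.
  by have := cos2Dsin2 (pi / 3 : R); rewrite cos_pi3 => h; lra.
rewrite expr2 qexpE cos_pi3 mulr1z.
move: (sin _) s2 => s s2.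
have -> : (2^-1%:A + s *: I) * (2^-1%:A + s *: I) =
   4^-1%:A + s ^+ 2 *: (I * I) + s *: I.
  by apply: quatP; rewrite !quatE; field.
rewrite -expr2 I2 s2.
by apply: quatP; rewrite !quatE; field.
Qed.

Lemma preserves_nontrivial L x J : sin x != 0 -> J ^+ 2 = -1 ->
  preserves L (qexp x J) -> Aut L <> pm1 R.
Proof.
move=> s0 J2 LJ; apply/Aut_nontrivial; exists (qexp x J).
have [_ sE] := qexp_coords x J2; have [J0 _] := iffLR (imag_unitE J) J2.
split=> //; first exact: qnormsq_qexp.
- move=> h; move/eqP: s0; apply; rewrite -sE h qdotE !quatE J0; ring.
- move=> h; move/eqP: s0; apply; rewrite -sE h qdotE !quatE J0; ring.
Qed.

End CyclicSubgroups.

Theorem theorem1p1 (R : realType) (L : lattice R) :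
  (Aut L <> pm1 R <-> type1 L \/ type2 L) /\
  (type1 L -> forall I : quat R, imag_units I ->
     has_subgroup_isom (Aut L) (cyclic2 2 I)) /\
  (type2 L -> forall I : quat R, imag_units I ->
     has_subgroup_isom (Aut L) (cyclic2 3 I)).
Proof.
split; [split|split].
- by move=> /Aut_nontrivial[a [Na La a1 aN1]]; exact: nontrivial_type La a1 aN1.
- case=> [/type1_preserves[J J2 LJ]|/type2_preserves[J J2 LJ]].
    by apply: preserves_nontrivial J2 LJ; rewrite sin_pihalf oner_neq0.
  by apply: preserves_nontrivial J2 LJ; rewrite gt_eqF// sin_pi3_gt0.
- by move=> /type1_preserves[J J2 LJ]; exact: (@preserves_subgroup R L 2 J).
- by move=> /type2_preserves[J J2 LJ]; exact: (@preserves_subgroup R L 3 J).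
Qed.
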